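(* Let $M$ be a matroid of rank $r$ and let $\mathcal F=\{\hat 0=F_0<F_1<\cdots<F_r=\hat 1\}$ be a complete flag (maximal chain) in its lattice of flats. Let $\operatorname{atom}(M)$ be the set of minimal non-$\hat 0$ flats of $M$, and let $S_G=S_G(\mathcal F)$ be the simplicial complexes defined in the context. Then $(S_{\hat 0}(\mathcal F),\{S_G(\mathcal F):G\in\operatorname{atom}(M)\})$ is a homotopy representation of $M$; that is, it is a homotopy $(r-1)$-arrangement, and its flats (as subsets of the index set $\operatorname{atom}(M)$) are exactly the sets $\{G\in\operatorname{atom}(M):G\subseteq F\}$ with $F\in M$, so that the poset of flats of the arrangement is identified with $M$ via $F\mapsto\{G\in\operatorname{atom}(M):G\subseteq F\}$.
   Context: A geometric lattice is a finite ranked lattice $L$ (least element $\hat 0$, greatest element $\hat 1$) in which every element is a join of atoms and $\operatorname{rank}(X)+\operatorname{rank}(Y)\ge \operatorname{rank}(X\wedge Y)+\operatorname{rank}(X\vee Y)$ for all $X,Y$. A rank $r$ matroid on a finite set $E$ is a collection $M$ of subsets of $E$ (called flats), ordered by inclusion, which is a rank $r$ geometric lattice, in which the meet of two elements is their intersection, and in which $E$ is the join of all atoms. For a flat $X\in M$, $\operatorname{coat}(X)$ denotes the set of coatoms of $M$ that are $\ge X$ (so $\operatorname{coat}(\hat 1)=\emptyset$). Construction. Given the complete flag $\mathcal F$, put $A_i=\operatorname{coat}(F_i)\setminus \operatorname{coat}(F_{i+1})$ for $i=0,\dots,r-1$; these sets partition the set of coatoms of $M$. Take two vertices $H_+,H_-$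 for each coatom $H$. For $G\in M$, $S_G=S_G(\mathcal F)$ is the simplicial complex whose maximal simplices are the sets $W_0\cup\cdots\cup W_{r-1}$, where for each $i$ independently, $W_i$ is either $\{H_+:H\in\operatorname{coat}(G)\cap A_i\}$ or $\{H_-:H\in\operatorname{coat}(G)\cap A_i\}$. In particular $S_{\hat 1}=\emptyset$, and every $S_G$ is a subcomplex of $S_{\hat 0}$. A homotopy $d$-arrangement is a simplicial complex $S$ together with a finite set $\mathcal A$ of subcomplexes of $S$ such that: (i) $S\simeq S^d$; (ii) each $T\in\mathcal A$ is homotopy equivalent to $S^{d-1}$; (iii) every intersection of elements of $\mathcal A$ is homotopy equivalent to a sphere; (iv) there is a free $\mathbb Z_2$ action on $S$ that restricts to an action on each $T\in\mathcal A$; (v) if $U\simeq S^{d'}$ is an intersection of elements of $\mathcal A$ and $T\in\mathcal A$ satisfies $U\not\subseteq T$, then $U\cap T\simeq S^{d'-1}$. Convention: $S^{-1}=\emptyset$, and the complex with no vertices is regarded as $S^{-1}$. If $(S,\{T_e:e\in I\})$ is a homotopy $d$-arrangement indexed by a finite set $I$, a subset $F\subseteq I$ is a flat of it if for every $e\in I\setminus F$, $(\bigcap_{f\in F}T_f)\cap T_e\ne\bigcap_{f\in F}T_f$ (the empty intersection being $S$). A homotopy arrangement is called a homotopy representation of the matroid formed by its flats. *)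

(* Defs.v *)
From HB Require Import structures.
From mathcomp Require Import all_boot all_order all_algebra all_fingroup.
From mathcomp Require Import all_classical all_reals all_analysis.

Set Implicit Arguments.
Unset Strict Implicit.
Unset Printing Implicit Defensive.

Import Order.TTheory GRing.Theory Num.Theory.
Import numFieldNormedType.Exports.

Local Open Scope ring_scope.

(* Both finset and classical_sets define this name. *)
Local Notation set0 := finset.set0.

Section Lattices.
Variables (E : finType) (M : {set {set E}}).
Implicit Types (A : {set {set E}}) (X Y Z : {set E}).

Definition is_join A Z :=
  [&& Z \in M, [forall X in A, X \subset Z] &
      [forall W in M, [forall X in A, X \subset W] ==> (Z \subset W)]].

Definition is_meet A Z :=
  [&& Z \in M, [forall X in A, Z \subset X] &
      [forall W in M, [forall X in A, W \subset X] ==> (W \subset Z)]].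

Definition is_least Z := (Z \in M) && [forall X in M, Z \subset X].

Definition is_greatest Z := (Z \in M) && [forall X in M, X \subset Z].

Definition covers X Y :=
  [&& X \in M, Y \in M, X \proper Y &
      ~~ [exists Z in M, (X \proper Z) && (Z \proper Y)]].

Definition atoms : {set {set E}} :=
  [set X | minset (fun Y => (Y \in M) && ~~ is_least Y) X].

Definition coatoms : {set {set E}} :=
  [set X | maxset (fun Y => (Y \in M) && ~~ is_greatest Y) X].

Definition coat X : {set {set E}} := [set H in coatoms | X \subset H].

Definition is_lattice :=
  M != set0 /\
  {in M &, forall X Y, (exists Z, is_meet [set X; Y] Z) /\
                       (exists Z, is_join [set X; Y] Z)}.

Definition is_rank_function (rk : {set E} -> nat) :=
  (forall Z, is_least Z -> rk Z = 0%N) /\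
  (forall X Y, covers X Y -> rk Y = (rk X).+1).

Definition geometric_lattice (r : nat) :=
  is_lattice /\
  exists rk : {set E} -> nat,
    [/\ is_rank_function rk,
        forall Z, is_greatest Z -> rk Z = r,
        forall X, X \in M -> exists2 A : {set {set E}}, A \subset atoms & is_join A X &
        forall X Y I J, X \in M -> Y \in M ->
          is_meet [set X; Y] I -> is_join [set X; Y] J ->
          (rk I + rk J <= rk X + rk Y)%N].

Definition matroid (r : nat) :=
  [/\ geometric_lattice r,
      {in M &, forall X Y, is_meet [set X; Y] (X :&: Y)} &
      is_join atoms [set: E]%SET].

Definition complete_flag (r : nat) (F : 'I_r.+1 -> {set E}) :=
  [/\ is_least (F ord0), is_greatest (F ord_max) &
      forall i : 'I_r, covers (F (widen_ord (leqnSn r) i)) (F (lift ord0 i))].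

End Lattices.

(* A complex is given by its set of nonempty simplices, so that the complex
   without vertices is the empty set. *)

Section Complexes.
Variable V : finType.
Implicit Types K S T : {set {set V}}.

Definition simplicial_complex K :=
  set0 \notin K /\
  forall s t : {set V}, s \in K -> t \subset s -> t != set0 -> t \in K.

Definition subcomplex T S := simplicial_complex T /\ T \subset S.

Definition geom_realization (R : realType) K : set {ptws V -> R} :=
  [set x : {ptws V -> R} |
    [/\ forall v, 0 <= x v, \sum_v x v = 1 & [set v | x v != 0]%SET \in K]]%classic.

End Complexes.

Definition homotopic (R : realType) (X Y : topologicalType) (f g : X -> Y) :=
  exists H : X * R -> Y,
    [/\ {within [set: X] `*` `[0, 1], continuous H}%classic,
        forall x, H (x, 0) = f x & forall x, H (x, 1) = g x].

Definition homotopy_equivalent (R : realType) (X Y : topologicalType) :=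
  exists (f : X -> Y) (g : Y -> X),
    [/\ continuous f, continuous g,
        homotopic R (g \o f) idfun & homotopic R (f \o g) idfun].

(* The sphere of dimension n - 1; it is empty for n = 0. *)
Definition unit_sphere (R : realType) (n : nat) : set 'rV[R]_n :=
  [set x : 'rV[R]_n | \sum_i x 0 i ^+ 2 = 1]%classic.

(* The dimension d ranges over the integers >= -1; the property is false for
   d < -1. *)
Definition homotopy_sphere (R : realType) (V : finType) (K : {set {set V}})
    (d : int) :=
  exists2 n : nat, d = n%:Z - 1 &
    homotopy_equivalent R (set_type (@geom_realization V R K))
                          (set_type (@unit_sphere R n)).

Section Arrangements.
Variables (R : realType) (V : finType).
Implicit Types (S T : {set {set V}}) (A B : {set {set {set V}}}).

Definition intersection S B : {set {set V}} := S :&: \bigcap_(T in B) T.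

(* A simplicial action, given on vertices; freeness is that of the induced
   action on the geometric realization. *)
Definition free_Z2_action S (to : {action 'Z_2 &-> V}) :=
  [acts [set: 'Z_2]%SET, on S | to^*] /\
  forall a : 'Z_2, a != 1%g ->
    forall x, @geom_realization V R S x -> (fun v => x (to v a^-1%g)) <> x.

Definition homotopy_arrangement (d : int) S A :=
  simplicial_complex S /\ {in A, forall T, subcomplex T S} /\
  [/\ homotopy_sphere R S d,
      {in A, forall T, homotopy_sphere R T (d - 1)},
      forall B, B \subset A ->
        exists d' : int, homotopy_sphere R (intersection S B) d',
      exists2 to : {action 'Z_2 &-> V}, free_Z2_action S to &
        {in A, forall T, [acts [set: 'Z_2]%SET, on T | to^*]} &
      forall B T (d' : int), B \subset A -> T \in A ->
        homotopy_sphere R (intersection S B) d' ->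
        ~~ (intersection S B \subset T) ->
        homotopy_sphere R (intersection S B :&: T) (d' - 1)].

Definition arrangement_flats (J : finType) S (I : {set J})
    (T : J -> {set {set V}}) : {set {set J}} :=
  [set F : {set J} | (F \subset I) &&
    [forall e in I :\: F,
      intersection S (T @: F) :&: T e != intersection S (T @: F)]]%SET.

End Arrangements.

Section FlagComplexes.
Variables (E : finType) (M : {set {set E}}) (r : nat) (F : 'I_r.+1 -> {set E}).

Definition flag_block (i : 'I_r) : {set {set E}} :=
  coat M (F (widen_ord (leqnSn r) i)) :\: coat M (F (lift ord0 i)).

(* The vertices H_+ and H_- are (H, true) and (H, false). *)
Definition flag_facet (G : {set E}) (w : {ffun 'I_r -> bool}) :
    {set {set E} * bool} :=
  \bigcup_(i < r) [set (H, w i) | H in coat M G :&: flag_block i].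

Definition flag_complex (G : {set E}) : {set {set ({set E} * bool)%type}} :=
  [set s : {set ({set E} * bool)%type} |
    (s != set0) && [exists w, s \subset flag_facet G w]]%SET.

End FlagComplexes.

Definition atoms_below (E : finType) (M : {set {set E}}) (X : {set E}) :
    {set {set E}} :=
  [set G in atoms M | G \subset X].

(* Main.v *)
Require Import Defs.
From mathcomp Require Import all_boot all_order all_algebra all_fingroup.
From mathcomp Require Import zify.

(* The simplices of S_G are the nonempty sets of signed coatoms above G whose signs
   agree on each block A_i.  Hence S_G and S_G' meet in S_(G v G'), and adding up
   signed barycentric coordinates over each block deforms S_G onto the boundary of a
   cross-polytope with one axis for each block that meets coat(G); semimodularity
   along the flag shows that there are r - rk G such blocks.

   Clause (v) of the definition of an arrangement quantifies over every d' such that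
   the intersection is a homotopy d'-sphere, so one also needs that spheres of different
   dimensions are not homotopy equivalent.  If m < n and f o g were homotopic to the
   identity of the sphere in R^n, with g mapping to and f from the sphere in R^m, then
   labelling the points of the cube [-1, 1]^n by the signs of the homotopy near the
   boundary, and by those of a fine colouring of f o g further inside, would contradict
   Sperner's lemma for the Kuhn triangulation of the cube. *)

Set Implicit Arguments.
Unset Strict Implicit.
Unset Printing Implicit Defensive.

(** * Flats and coatoms *)

(** The definition of a matroid speaks of joins of atoms, whereas the complexes are built from
    coatoms. The bridge is that a flat is also determined by the coatoms above it ([coatomistic]).
    This makes a jump of the rank along the flag visible as a block meeting [coat M G], and it makes
    [S_X] determine [X], as the description of the arrangement flats requires. The obstacle in
    comparing spheres is that the maps are merely continuous: a map from a sphere of lower dimension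
    may be onto, so no missed point can be used. What survives is a count of colours. The sphere in
    R^m has covering dimension m - 1, and a fine colouring shows at most m colours near any point.
    The constant label in the core of the cube adds one, and m + 1 < n + 1 labels fall short of what
    Sperner's lemma produces. Only one composite enters, so the argument serves whichever sphere is
    the larger. *)

Section Closure.
Variables (E : finType) (M : {set {set E}}) (r : nat).
Hypothesis hM : matroid M r.
Implicit Types (X Y Z G H : {set E}) (A : {set {set E}}).

(** Flats are closed under intersection and [E] is a flat, so this is the least flat containing [X].
    It turns relational joins into a function: [cl set0] is the bottom flat, possibly nonempty, and
    [cl (X :|: Y)] is the join. *)
Definition flat_closure X := \bigcap_(Z in M | X \subset Z) Z.
Local Notation cl := flat_closure.

Lemma setT_flat : [set: E] \in M.
Proof. by case: hM => _ _ /and3P[]. Qed.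

Lemma flatI X Y : X \in M -> Y \in M -> X :&: Y \in M.
Proof. by case: hM => _ meetI _ XM YM; have /and3P[] := meetI X Y XM YM. Qed.

Lemma flat_closure_flat X : cl X \in M.
Proof.
by apply: (big_ind (fun Z => Z \in M)) => [|Y Z|Z /andP[]] //; [exact: setT_flat|exact: flatI].
Qed.

Lemma sub_flat_closure X : X \subset cl X.
Proof. by apply/bigcapsP => Z /andP[]. Qed.

Lemma flat_closure_sub X Z : Z \in M -> (cl X \subset Z) = (X \subset Z).
Proof.
move=> ZM; apply/idP/idP => [|XZ]; first exact: subset_trans (sub_flat_closure X).
by apply: bigcap_inf; rewrite ZM.
Qed.

Lemma flat_closure_id X : X \in M -> cl X = X.
Proof.
by move=> XM; apply/eqP; rewrite eqEsubset flat_closure_sub // subxx sub_flat_closure.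
Qed.

Lemma is_leastP Z : is_least M Z <-> Z = cl set0.
Proof.
split=> [/andP[ZM /forall_inP Zle]|->].
  apply/eqP; rewrite eqEsubset flat_closure_sub // sub0set andbT.
  exact/Zle/flat_closure_flat.
rewrite /is_least flat_closure_flat; apply/forall_inP => X XM.
by rewrite flat_closure_sub // sub0set.
Qed.

Lemma is_greatestP Z : is_greatest M Z <-> Z = [set: E].
Proof.
split=> [/andP[_ /forall_inP/(_ _ setT_flat)]|->]; first by rewrite subTset => /eqP.
by rewrite /is_greatest setT_flat; apply/forall_inP => X _; exact: subsetT.
Qed.

Lemma is_join_closure X Y : is_join M [set X; Y] (cl (X :|: Y)).
Proof.
apply/and3P; split; first exact: flat_closure_flat.
  apply/forall_inP => Z; rewrite !inE => /orP[]/eqP->;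
  by apply: subset_trans (sub_flat_closure _); rewrite ?subsetUl ?subsetUr.
apply/forall_inP => W WM; apply/implyP => /forall_inP XYW.
by rewrite flat_closure_sub // subUset !XYW // !inE eqxx ?orbT.
Qed.

Lemma exists_cover X Y : X \in M -> Y \in M -> X \proper Y ->
  exists2 Z, covers M X Z & Z \subset Y.
Proof.
move=> XM YM XY.
pose P Z := [&& Z \in M, X \proper Z & Z \subset Y].
have PY : P Y by rewrite /P YM XY subxx.
case: (arg_minnP (fun Z : {set E} => #|Z|) PY) => Z /and3P[ZM XZ ZY] Zmin.
exists Z => //; apply/and4P; split=> //; apply/negP => /exists_inP[W WM /andP[XW WZ]].
have := Zmin W; rewrite /P WM XW (subset_trans (proper_sub WZ) ZY) => /(_ isT).
by rewrite leqNgt proper_card.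
Qed.

Lemma atom_flat G : G \in atoms M -> G \in M.
Proof. by rewrite inE => /minsetP[/andP[]]. Qed.

Lemma atom_min G X : G \in atoms M -> X \in M -> X \proper G -> X = cl set0.
Proof.
rewrite inE => /minsetP[_ Gmin] XM XG; apply/is_leastP; apply: contraTT XG => Xl.
apply/negP => XG; move: (XG).
by rewrite (Gmin X) ?properxx ?XM // proper_sub.
Qed.

Lemma atom_neq G : G \in atoms M -> cl set0 \proper G.
Proof.
move=> Ga; have GM := atom_flat Ga.
rewrite properEneq flat_closure_sub // sub0set andbT; apply/eqP => E0.
by move: Ga; rewrite inE => /minsetP[/andP[_ /negP Gl] _]; apply: Gl; exact/is_leastP.
Qed.

Lemma atom_covers G : G \in atoms M -> covers M (cl set0) G.
Proof.
move=> Ga; apply/and4P; split; rewrite ?flat_closure_flat ?atom_flat ?atom_neq //.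
apply/negP => /exists_inP[W WM /andP[/proper_neq]].
by move=> /eqP W0 /(atom_min Ga WM) /esym.
Qed.

Lemma coatomP H : reflect [/\ H \in M, H != [set: E] &
    forall Z, Z \in M -> H \proper Z -> Z = [set: E]] (H \in coatoms M).
Proof.
rewrite inE; apply: (iffP maxsetP) => [[/andP[HM Hg] Hmax]|[HM HT Hmax]].
  split=> //; first by apply: contra Hg => /eqP /is_greatestP.
  move=> Z ZM HZ; apply/is_greatestP; apply: contraTT HZ => Zg.
  rewrite properE negb_and negbK; case: (boolP (H \subset Z)) => // HZ /=.
  by rewrite (Hmax Z) ?ZM.
split; first by rewrite HM; apply: contra HT => /is_greatestP ->.
move=> Z /andP[ZM Zg] HZ; apply/eqP; rewrite eq_sym; apply: contraNT Zg => HneZ.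
by apply/is_greatestP; apply: Hmax => //; rewrite properEneq HneZ.
Qed.

Lemma mem_coat X H : (H \in coat M X) = (H \in coatoms M) && (X \subset H).
Proof. by rewrite inE. Qed.

Lemma coatU X Y : coat M X :&: coat M Y = coat M (cl (X :|: Y)).
Proof.
apply/setP => H; rewrite inE !mem_coat; case: coatomP => //= -[HM _ _].
by rewrite flat_closure_sub // subUset.
Qed.

Lemma atomistic X Y : X \in M -> Y \in M ->
  (forall G, G \in atoms M -> G \subset X -> G \subset Y) -> X \subset Y.
Proof.
case: hM => -[_ [rk [_ _ atomic _]]] _ _ XM YM XY.
have [A Aatoms /and3P[_ /forall_inP AX /forall_inP minX]] := atomic X XM.
apply: (implyP (minX Y YM)); apply/forall_inP => G GA.
by apply: XY (AX G GA); exact: subsetP GA.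
Qed.

(** The definition of a geometric lattice only asserts that a rank function exists; these are its
    properties with joins written through [cl], so that one fixed [rk] serves all later lemmas. *)
Definition flat_rank (rk : {set E} -> nat) :=
  [/\ rk (cl set0) = 0, rk [set: E] = r,
      forall X Y, covers M X Y -> rk Y = (rk X).+1 &
      forall X Y, X \in M -> Y \in M ->
        rk (X :&: Y) + rk (cl (X :|: Y)) <= rk X + rk Y].

Lemma flat_rank_ex : exists rk, flat_rank rk.
Proof.
case: hM => -[_ [rk [[rk0 rkS] rkT _ rksub]]] meetI _; exists rk; split=> //.
- by apply: rk0; exact/is_leastP.
- by apply: rkT; exact/is_greatestP.
- by move=> X Y XM YM; apply: rksub => //; [exact: meetI|exact: is_join_closure].
Qed.

(** * Rank of flats, and separation of flats by coatoms *)

Section Rank.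
Variable rk : {set E} -> nat.
Hypothesis hrk : flat_rank rk.

Let rk0 : rk (cl set0) = 0. Proof. by case: hrk. Qed.
Let rkT : rk [set: E] = r. Proof. by case: hrk. Qed.
Let rk_covers X Y : covers M X Y -> rk Y = (rk X).+1.
Proof. by case: hrk => _ _ + _; exact. Qed.
Let rk_submod X Y : X \in M -> Y \in M ->
  rk (X :&: Y) + rk (cl (X :|: Y)) <= rk X + rk Y.
Proof. by case: hrk => _ _ _; exact. Qed.

(** The rank is specified on covers alone, so the proof climbs from [X] towards [Y] one cover at a
    time, by induction on [#|Y| - #|X|]. *)
Lemma rk_lt X Y : X \in M -> Y \in M -> X \proper Y -> rk X < rk Y.
Proof.
have [n] := ubnP (#|Y| - #|X|); elim: n X => // n IH X; rewrite ltnS => XYn XM YM XY.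
have [Z XZ ZY] := exists_cover XM YM XY; have := rk_covers XZ.
case/and4P: XZ => _ ZM XZ _ rkZ.
case: (eqVneq Z Y) => [<-|ZneY]; first by rewrite rkZ.
have ZpY : Z \proper Y by rewrite properEneq ZneY.
apply: leq_trans (_ : rk Z < _); first by rewrite rkZ.
apply: IH => //; apply: leq_trans XYn.
by rewrite ltn_sub2l ?proper_card // (proper_card (proper_trans XZ ZpY)).
Qed.

Lemma rk_le X Y : X \in M -> Y \in M -> X \subset Y -> rk X <= rk Y.
Proof.
move=> XM YM; rewrite subEproper => /predU1P[->//|XY]; exact/ltnW/rk_lt.
Qed.

Lemma rk_le_r X : X \in M -> rk X <= r.
Proof. by move=> XM; rewrite -rkT rk_le ?setT_flat ?subsetT. Qed.

Lemma rk_atom G : G \in atoms M -> rk G = 1.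
Proof. by move=> /atom_covers/rk_covers; rewrite rk0. Qed.

(** Semimodularity with an atom, of rank 1, allows a growth of at most one, and strict inclusion
    forces at least one. This is the source of the drop of dimension by one in clause (v). *)
Lemma rk_join_atom X G : X \in M -> G \in atoms M -> ~~ (G \subset X) ->
  rk (cl (X :|: G)) = (rk X).+1.
Proof.
move=> XM Ga GX; apply/eqP; rewrite eqn_leq; apply/andP; split.
  have := rk_submod XM (atom_flat Ga); rewrite (rk_atom Ga); lia.
apply: rk_lt; rewrite ?flat_closure_flat // properE.
rewrite (subset_trans (subsetUl X G) (sub_flat_closure _)) /=.
by rewrite flat_closure_sub // subUset subxx.
Qed.

(* A flat maximal among those containing X but not Y is a coatom: otherwise there is
   a flat W strictly between it and the whole set, and an atom outside W would
   generate with it a cover, which must contain Y and hence be its join with Y,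
   a subset of W. *)
Lemma coatomistic X Y : X \in M -> Y \in M -> ~~ (Y \subset X) ->
  exists H, [/\ H \in coatoms M, X \subset H & ~~ (Y \subset H)].
Proof.
move=> XM YM YX; pose P Z := [&& Z \in M, X \subset Z & ~~ (Y \subset Z)].
have PX : P X by rewrite /P XM YX subxx.
case: (arg_maxnP (fun Z : {set E} => #|Z|) PX) => H /and3P[HM XH YH] Hmax.
have above Z : Z \in M -> H \proper Z -> Y \subset Z.
  move=> ZM HZ; apply: contraT => YZ.
  have : P Z by rewrite /P ZM YZ (subset_trans XH (proper_sub HZ)).
  by move/Hmax => /=; rewrite leqNgt proper_card.
exists H; split=> //; apply/coatomP; split=> //.
  by apply: contra YH => /eqP ->; exact: subsetT.
move=> W WM HW; apply/eqP; apply: contraT => WT.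
have [a aa aW] : exists2 a, a \in atoms M & ~~ (a \subset W).
  apply/exists_inP; apply: contraT; rewrite negb_exists_in => /forall_inP noa.
  suff : [set: E] \subset W by rewrite subTset (negbTE WT).
  by apply: atomistic; rewrite ?setT_flat // => G Ga _; have := noa G Ga; rewrite negbK.
have aH : ~~ (a \subset H).
  by apply: contra aW => aH; exact: subset_trans aH (proper_sub HW).
have YHa : Y \subset cl (H :|: a).
  apply: above; first exact: flat_closure_flat.
  rewrite properE (subset_trans (subsetUl H a) (sub_flat_closure _)) /=.
  by rewrite flat_closure_sub // subUset subxx.
have HY_M : cl (H :|: Y) \in M by exact: flat_closure_flat.
have HYsub : cl (H :|: Y) \subset cl (H :|: a).
  rewrite flat_closure_sub ?flat_closure_flat // subUset YHa andbT.
  exact: subset_trans (subsetUl H a) (sub_flat_closure _).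
have HHY : H \proper cl (H :|: Y).
  rewrite properE (subset_trans (subsetUl H Y) (sub_flat_closure _)) /=.
  by rewrite flat_closure_sub // subUset subxx.
have HYW : cl (H :|: Y) \subset W.
  by rewrite flat_closure_sub // subUset (proper_sub HW) above.
have : ~~ (cl (H :|: Y) \proper cl (H :|: a)).
  apply/negP => /(rk_lt HY_M (flat_closure_flat _)).
  by rewrite (rk_join_atom HM aa aH) ltnS leqNgt (rk_lt HM HY_M HHY).
rewrite properE HYsub negbK => Ha_sub.
case/negP: aW; apply: subset_trans HYW; apply: subset_trans Ha_sub.
exact: subset_trans (subsetUr H a) (sub_flat_closure _).
Qed.

Lemma coat_sub X Y : X \in M -> Y \in M -> (coat M X \subset coat M Y) = (Y \subset X).
Proof.
move=> XM YM; apply/subsetP/idP => [XY|YX H]; last first.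
  by rewrite !mem_coat => /andP[-> /(subset_trans YX)].
apply: contraT => /(coatomistic XM YM)[H [Hc XH /negP[]]].
by have := XY H; rewrite !mem_coat Hc XH => /(_ isT).
Qed.

(** * The partition of the coatoms by a complete flag *)

Section Flag.
Variable F : 'I_r.+1 -> {set E}.
Hypothesis hF : complete_flag M F.

(** Natural indices make consecutive flats [Fn i] and [Fn i.+1] without casts; [inord] is faithful
    up to [r] only, whence the bounds in the lemmas on [Fn]. *)
Let Fn (i : nat) := F (inord i).

Lemma flag_widen (i : 'I_r) : F (widen_ord (leqnSn r) i) = Fn i.
Proof. by congr F; apply: val_inj; rewrite /= inordK // ltnS ltnW. Qed.

Lemma flag_lift (i : 'I_r) : F (lift ord0 i) = Fn i.+1.
Proof. by congr F; apply: val_inj; rewrite /= inordK ?ltnS. Qed.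

Lemma flag0 : F ord0 = cl set0.
Proof. by case: hF => /is_leastP. Qed.

Lemma Fn0 : Fn 0 = cl set0.
Proof. by rewrite -flag0; congr F; apply: val_inj; rewrite /= inordK. Qed.

Lemma Fnr : Fn r = [set: E].
Proof.
by case: hF => _ /is_greatestP <- _; congr F; apply: val_inj; rewrite /= inordK.
Qed.

Lemma Fn_covers i : i < r -> covers M (Fn i) (Fn i.+1).
Proof.
by case: hF => _ _ cov ir; have := cov (Ordinal ir); rewrite flag_widen flag_lift.
Qed.

Lemma Fn_flat i : i <= r -> Fn i \in M.
Proof.
case: i => [_|i ir]; first by rewrite Fn0 flat_closure_flat.
by case/and4P: (Fn_covers ir).
Qed.

Lemma Fn_mono i j : i <= j -> j <= r -> Fn i \subset Fn j.
Proof.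
elim: j => [|j IH]; first by rewrite leqn0 => /eqP ->.
rewrite leq_eqVlt => /predU1P[->//|ij] jr.
apply: subset_trans (IH ij (ltnW jr)) _.
by case/and4P: (Fn_covers jr) => _ _ /proper_sub.
Qed.

Lemma mem_flag_block H (i : 'I_r) : (H \in flag_block M F i) =
  [&& H \in coatoms M, Fn i \subset H & ~~ (Fn i.+1 \subset H)].
Proof.
by rewrite /flag_block flag_widen flag_lift inE !mem_coat andbC; case: (H \in coatoms M).
Qed.

(** The block is that of the last flat of the flag below [H]. There is one because the flag starts
    at the bottom, and it is not [Fn r] because [H] is not [E]. *)
Lemma flag_block_ex H : H \in coatoms M -> exists i, H \in flag_block M F i.
Proof.
move=> Hc; have /coatomP[HM HT _] := Hc.
have F0H : Fn 0 \subset H by rewrite Fn0 flat_closure_sub // sub0set.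
have ex0 : exists i, (i <= r) && (Fn i \subset H) by exists 0.
case: (ex_maxnP ex0 (m := r)) => [i /andP[]//|i /andP[ir FiH] imax].
have ir' : i < r.
  rewrite ltn_neqAle ir andbT; apply: contra HT => /eqP E0; move: FiH.
  by rewrite E0 Fnr subTset.
exists (Ordinal ir'); rewrite mem_flag_block Hc FiH /=.
by apply/negP => FSH; have := imax i.+1; rewrite ir' FSH ltnn => /(_ isT).
Qed.

Lemma flag_block_inj H (i j : 'I_r) :
  H \in flag_block M F i -> H \in flag_block M F j -> i = j.
Proof.
rewrite !mem_flag_block => /and3P[_ iH iSH] /and3P[_ jH jSH].
apply: val_inj; case: (ltngtP i j) => // ij.
  by case/negP: iSH; apply: subset_trans jH; rewrite Fn_mono // ltnW.
by case/negP: jSH; apply: subset_trans iH; rewrite Fn_mono // ltnW.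
Qed.

Definition live_blocks G := [set i : 'I_r | coat M G :&: flag_block M F i != set0].

(* Along the flag the rank of cl (G :|: F_i) grows by 0 or 1 at each step, and grows
   exactly when the i-th block meets coat G. *)
Lemma card_live_blocks G : G \in M -> #|live_blocks G| = r - rk G.
Proof.
move=> GM; pose rho i := rk (cl (G :|: Fn i)).
have flatG i : cl (G :|: Fn i) \in M by exact: flat_closure_flat.
have step_sub i : i < r -> cl (G :|: Fn i) \subset cl (G :|: Fn i.+1).
  move=> ir; rewrite flat_closure_sub ?flatG //.
  by apply: subset_trans (sub_flat_closure _); rewrite setUS // Fn_mono.
have step1 i : i < r -> rho i.+1 <= (rho i).+1.
  move=> ir; have FiM := Fn_flat (ltnW ir); have FSM := Fn_flat ir.
  have E1 : cl (cl (G :|: Fn i) :|: Fn i.+1) = cl (G :|: Fn i.+1).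
    apply/eqP; rewrite eqEsubset !flat_closure_sub ?flat_closure_flat // !subUset.
    rewrite step_sub //=; apply/andP; split.
      by apply: subset_trans (sub_flat_closure _); exact: subsetUr.
    rewrite (subset_trans (subsetUr _ _) (sub_flat_closure _)) andbT.
    apply: subset_trans (sub_flat_closure _); apply: subset_trans (subsetUl _ _).
    by apply: subset_trans (sub_flat_closure _); exact: subsetUl.
  (* Semimodularity for [cl (G :|: Fn i)] and [Fn i.+1]: their meet contains [Fn i], so the growth
     is at most [rk (Fn i.+1) - rk (Fn i)], which is 1. *)
  have := rk_submod (flatG i) FSM; rewrite E1 -/(rho i) -/(rho i.+1).
  rewrite (rk_covers (Fn_covers ir)).
  have : rk (Fn i) <= rk (cl (G :|: Fn i) :&: Fn i.+1).
    apply: rk_le; rewrite ?flatI // subsetI Fn_mono // andbT.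
    by apply: subset_trans (sub_flat_closure _); exact: subsetUr.
  by lia.
have step_mono i : i < r -> rho i <= rho i.+1 by move=> ir; rewrite rk_le // step_sub.
have live (i : 'I_r) : rho i.+1 - rho i = (i \in live_blocks G).
  have ir := ltn_ord i; have := step1 i ir; have := step_mono i ir.
  (* Intersecting the block with [coat M G] gives the coatoms above [cl (G :|: Fn i)] but not above
     [cl (G :|: Fn i.+1)]; by [coat_sub] there is one exactly when these flats differ. *)
  have -> : (i \in live_blocks G) = ~~ (cl (G :|: Fn i.+1) \subset cl (G :|: Fn i)).
    rewrite inE -coat_sub ?flatG // -!coatU /flag_block flag_widen flag_lift setIDA.
    by rewrite setD_eq0 subsetI negb_and (subsetIl (coat M G)).
  case: (boolP (_ \subset _)) => [sub|nsub] /=.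
    by have := rk_le (flatG i.+1) (flatG i) sub; rewrite -/(rho i) -/(rho i.+1); lia.
  have : rho i < rho i.+1 by apply: rk_lt; rewrite ?flatG // properE step_sub.
  by lia.
have -> : #|live_blocks G| = \sum_(i < r) (rho i.+1 - rho i).
  by rewrite -sum1_card big_mkcond; apply: eq_bigr => i _; rewrite live; case: ifP.
have tele n : n <= r -> \sum_(i < n) (rho i.+1 - rho i) = rho n - rho 0 /\ rho 0 <= rho n.
  elim: n => [|n IH] nr; first by rewrite big_ord0 subnn.
  have [IH1 IH2] := IH (ltnW nr); rewrite big_ord_recr /= IH1.
  by have := step_mono n nr; lia.
have [-> _] := tele r (leqnn r).
rewrite /rho Fnr setUT (flat_closure_id setT_flat) rkT Fn0; congr (r - rk _).
apply/eqP; rewrite eqEsubset flat_closure_sub // subUset subxx flat_closure_sub // sub0set.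
by apply: subset_trans (sub_flat_closure _); exact: subsetUl.
Qed.

End Flag.
End Rank.
End Closure.

(** * The flag complexes *)

Section FlagComplex.
Variables (E : finType) (M : {set {set E}}) (r : nat).
Hypothesis hM : matroid M r.
Variable F : 'I_r.+1 -> {set E}.
Hypothesis hF : complete_flag M F.
Implicit Types (X Y Z G H : {set E}) (s t : {set {set E} * bool}).
Local Notation cl := (flat_closure M).
Local Notation S := (flag_complex M F).

Lemma flag_complexP G s : reflect
  [/\ s != set0, {in s, forall v, v.1 \in coat M G} &
      {in s &, forall v w i, v.1 \in flag_block M F i -> w.1 \in flag_block M F i -> v.2 = w.2}]
  (s \in S G).
Proof.
rewrite inE; apply: (iffP andP) => [[s0 /existsP[e /subsetP se]]|[s0 sG sE]].
  have mem_facet v : v \in s -> exists i, [/\ v.1 \in coat M G, v.1 \in flag_block M F i & v.2 = e i].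
    move=> /se/bigcupP[i _ /imsetP[H]]; rewrite inE => /andP[HG Hi] ->.
    by exists i.
  split=> // [v /mem_facet[i []]//|v w /mem_facet[i [_ vi ->]] /mem_facet[j [_ wj ->]] l vl wl].
  by rewrite (flag_block_inj hF vi vl) (flag_block_inj hF wj wl).
split=> //; apply/existsP.
(* The sign vector is read off [s]: positive where [s] has a positive vertex in the block, negative
   otherwise, also on blocks that [s] misses. *)
exists [ffun i => [exists v in s, (v.1 \in flag_block M F i) && v.2]].
apply/subsetP => -[H e] vs; have HG : H \in coat M G := sG _ vs.
have [i Hi] : exists i, H \in flag_block M F i.
  by apply: (flag_block_ex hM hF); move: HG; rewrite mem_coat => /andP[].
apply/bigcupP; exists i => //; apply/imsetP; exists H; first by rewrite inE HG.
congr (_, _); rewrite ffunE; case: e vs => vs; apply/esym.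
  by apply/exists_inP; exists (H, true) => //=; rewrite Hi.
apply/negbTE/negP => /exists_inP[w ws /andP[wi w2]].
by have := sE _ _ vs ws i Hi wi; rewrite w2.
Qed.

Lemma flag_complex_simplicial G : simplicial_complex (S G).
Proof.
split=> [|s t /flag_complexP[s0 sG sE] /subsetP ts t0].
  by apply/negP => /flag_complexP[]; rewrite eqxx.
by apply/flag_complexP; split=> // [v /ts/sG//|v w /ts vs /ts ws]; exact: sE.
Qed.

Lemma flag_complexI G G' : S G :&: S G' = S (cl (G :|: G')).
Proof.
apply/setP => s; rewrite inE; apply/andP/flag_complexP.
  move=> [/flag_complexP[s0 sG sE] /flag_complexP[_ sG' _]]; split=> // v vs.
  by rewrite -(coatU hM) inE sG ?sG'.
rewrite -(coatU hM) => -[s0 sG sE].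
by split; apply/flag_complexP; split=> // v /sG; rewrite inE => /andP[].
Qed.

(** The vertices of [S X] recover [coat M X], each as a singleton simplex, and the coatoms recover
    the flat by [coat_sub]. *)
Lemma flag_complex_sub X Y : X \in M -> Y \in M -> (S X \subset S Y) = (Y \subset X).
Proof.
move=> XM YM.
have [rk hrk] := flat_rank_ex hM.
rewrite -(coat_sub hM hrk) //; apply/subsetP/subsetP => [XY H HX|XY s].
  have : [set (H, true)] \in S X.
    apply/flag_complexP; split=> [|v|v w].
    - by apply/set0Pn; exists (H, true); rewrite inE.
    - by rewrite inE => /eqP ->.
    - by rewrite !inE => /eqP -> /eqP ->.
  by move=> /XY/flag_complexP[_ /(_ (H, true)) + _]; rewrite inE eqxx => /(_ isT).
by move=> /flag_complexP[s0 sX sE]; apply/flag_complexP; split=> // v /sX/XY.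
Qed.

Lemma flag_complex_inj X Y : X \in M -> Y \in M -> S X = S Y -> X = Y.
Proof.
move=> XM YM XY; apply/eqP; rewrite eqEsubset.
by rewrite -!flag_complex_sub // XY !subxx.
Qed.

Lemma intersection_flag_complex (A : {set {set E}}) : A \subset atoms M ->
  intersection (S (F ord0)) (S @: A) = S (cl (cover A)).
Proof.
move=> Aatoms; rewrite /intersection; apply/setP => s; rewrite (flag0 hM hF) in_setI.
have covA H : H \in coatoms M -> (cl (cover A) \subset H) = [forall G in A, G \subset H].
  move=> /(coatomP hM)[HM _ _]; rewrite flat_closure_sub //.
  by apply/bigcupsP/forall_inP.
apply/andP/flag_complexP => [[/flag_complexP[s0 s1 sE] /bigcapP sA]|[s0 s1 sE]].
  split=> // v vs; have := s1 v vs; rewrite !mem_coat => /andP[vc _].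
  rewrite vc covA //; apply/forall_inP => G GA.
  have /flag_complexP[_ /(_ v vs) + _] := sA (S G) (imset_f _ GA).
  by rewrite mem_coat => /andP[].
have v_coat v : v \in s -> v.1 \in coatoms M /\ forall G, G \in A -> G \subset v.1.
  by move/s1; rewrite mem_coat => /andP[vc]; rewrite covA // => /forall_inP.
split.
  apply/flag_complexP; split=> // v /v_coat[vc _]; rewrite mem_coat vc.
  by have /(coatomP hM)[HM _ _] := vc; rewrite flat_closure_sub // sub0set.
apply/bigcapP => _ /imsetP[G GA ->]; apply/flag_complexP; split=> // v /v_coat[vc vA].
by rewrite mem_coat vc vA.
Qed.

(** Clauses (iii) and (v) quantify over sets of complexes, so [B] is pulled back to the set of all
    atoms whose complex belongs to it; for empty [B] the flat found is the bottom one. *)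
Lemma intersection_flag_complex_ex (B : {set {set {set {set E} * bool}}}) :
  B \subset [set S G | G in atoms M] ->
  exists2 X, X \in M & intersection (S (F ord0)) B = S X.
Proof.
move=> /subsetP BA; pose A := [set G in atoms M | S G \in B].
exists (cl (cover A)); first exact: flat_closure_flat hM _.
rewrite -intersection_flag_complex; last by apply/subsetP => G; rewrite inE => /andP[].
congr (intersection _ _); apply/setP => T; apply/idP/imsetP => [TB|[G]].
  have /imsetP[G Ga TG] := BA T TB.
  by exists G => //; rewrite inE Ga -TG.
by rewrite inE => /andP[_ GB] ->.
Qed.

Lemma subcomplex_flag_complex G : G \in M -> subcomplex (S G) (S (F ord0)).
Proof.
move=> GM; split; first exact: flag_complex_simplicial.
have F0M : F ord0 \in M by rewrite (flag0 hM hF) (flat_closure_flat hM).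
by rewrite flag_complex_sub // (flag0 hM hF) flat_closure_sub // sub0set.
Qed.

Lemma cover_atoms_below X : X \in M -> cl (cover (atoms_below M X)) = X.
Proof.
move=> XM; apply/eqP; rewrite eqEsubset flat_closure_sub //; apply/andP; split.
  by apply/bigcupsP => G; rewrite inE => /andP[].
apply: (atomistic hM) => //; first exact: (flat_closure_flat hM).
move=> G Ga GX; apply: subset_trans (sub_flat_closure M _).
have GXin : G \in atoms_below M X by rewrite inE Ga.
exact: bigcup_max GXin (subxx _).
Qed.

Lemma atoms_below_sub X Y : X \in M -> Y \in M ->
  (atoms_below M X \subset atoms_below M Y) = (X \subset Y).
Proof.
move=> XM YM; apply/subsetP/idP => [XY|XY G].
  apply: (atomistic hM) => // G Ga GX.
  by have := XY G; rewrite !inE in Ga *; rewrite Ga GX => /(_ isT) /andP[].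
by rewrite !inE => /andP[-> /subset_trans->].
Qed.

(** A flat [A] of the arrangement contains every atom below [X = cl (cover A)], since such an atom
    does not shrink the intersection [S X]. Conversely an atom not below [X] does shrink it, as [S]
    is injective on flats. *)
Lemma arrangement_flats_flag :
  arrangement_flats (S (F ord0)) (atoms M) S = [set atoms_below M X | X in M].
Proof.
apply/setP => A; rewrite inE; apply/andP/imsetP => [[Aatoms /forall_inP Aflat]|[X XM ->]].
  have XM : cl (cover A) \in M by exact: (flat_closure_flat hM).
  exists (cl (cover A)) => //; apply/setP => G; rewrite inE; apply/idP/andP => [GA|[Ga GX]].
    split; first exact: (subsetP Aatoms).
    by apply: subset_trans (sub_flat_closure M _); exact: (bigcup_sup G).
  apply: contraT => GA; have := Aflat G; rewrite inE GA Ga => /(_ isT).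
  rewrite intersection_flag_complex // flag_complexI.
  by rewrite (setUidPl GX) (flat_closure_id XM) eqxx.
have sub : atoms_below M X \subset atoms M by apply/subsetP => G; rewrite inE => /andP[].
split=> //; apply/forall_inP => G; rewrite in_setD => /andP[GX Ga].
rewrite intersection_flag_complex // cover_atoms_below // flag_complexI.
apply: contra GX => /eqP/flag_complex_inj E0; rewrite inE Ga.
rewrite -(E0 (flat_closure_flat hM _) XM).
by apply: subset_trans (sub_flat_closure M _); exact: subsetUr.
Qed.

(** * Live blocks as the axes of a cross-polytope *)

Section Blocks.
Variable G : {set E}.
Local Notation J := (live_blocks M F G).

(** Live blocks are renumbered by ['I_#|J|], one number per axis; [None] marks the vertices whose
    coatom is not above [G]. *)
Definition flag_blk (v : {set E} * bool) : option 'I_#|J| :=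
  [pick j | (v.1 \in coat M G) && (v.1 \in flag_block M F (enum_val j))].

(** The default [set0] is never reached, because a live block meets [coat M G]. *)
Definition flag_rep (j : 'I_#|J|) (e : bool) : {set E} * bool :=
  (odflt set0 [pick H in coat M G :&: flag_block M F (enum_val j)], e).

Lemma flag_blkP v j : reflect (v.1 \in coat M G /\ v.1 \in flag_block M F (enum_val j))
  (flag_blk v == Some j).
Proof.
rewrite /flag_blk; case: pickP => [i /andP[vG vi]|none].
  apply: (iffP eqP) => [[<-]//|[_ vj]]; congr Some; apply: enum_val_inj.
  exact: (flag_block_inj hF) vi vj.
by apply: (iffP idP) => // -[vG vj]; have := none j; rewrite vG vj.
Qed.

Lemma flag_blk_ex v : v.1 \in coat M G -> exists j, flag_blk v = Some j.
Proof.
move=> vG; have [i vi] : exists i, v.1 \in flag_block M F i.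
  by apply: (flag_block_ex hM hF); move: vG; rewrite mem_coat => /andP[].
have iJ : i \in J by rewrite inE; apply/set0Pn; exists v.1; rewrite inE vG.
by exists (enum_rank_in iJ i); apply/eqP/flag_blkP; rewrite enum_rankK_in.
Qed.

Lemma flag_blk_rep j e : flag_blk (flag_rep j e) = Some j.
Proof.
apply/eqP/flag_blkP; have := enum_valP j; rewrite inE => /set0Pn[H HJ].
rewrite /flag_rep; case: pickP => [H' /=|/(_ H)]; last by rewrite HJ.
by rewrite inE => /andP[].
Qed.

Lemma flag_complex_blkP s : reflect
  [/\ s != set0, {in s, forall v, flag_blk v != None} &
      {in s &, forall v w, flag_blk v = flag_blk w -> v.2 = w.2}]
  (s \in S G).
Proof.
apply: (iffP (flag_complexP _ _)) => -[s0 sG sE]; split=> //.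
- by move=> v /sG/flag_blk_ex[j ->].
- move=> v w vs ws vw; have [j vj] := flag_blk_ex (sG v vs).
  have /eqP/flag_blkP[_ vjb] := vj; rewrite vw in vj.
  by have /eqP/flag_blkP[_ wjb] := vj; exact: sE vs ws _ vjb wjb.
- move=> v /sG; case Ev : (flag_blk v) => [j|] // _.
  by have /eqP/flag_blkP[] := Ev.
move=> v w vs ws i vi wi; apply: sE => //.
have mem_s u : u \in s -> u.1 \in coat M G.
  by move=> /sG; case Eu : (flag_blk u) => [j|] // _; have /eqP/flag_blkP[] := Eu.
have [j vj] := flag_blk_ex (mem_s v vs); rewrite vj; apply/esym/eqP/flag_blkP.
have /eqP/flag_blkP[_ vjb] := vj; split; first exact: mem_s.
by rewrite -(flag_block_inj hF vi vjb).
Qed.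

End Blocks.

Definition flip (v : {set E} * bool) (a : 'Z_2) := (v.1, v.2 (+) odd a).

Lemma flip1 v : flip v 1%g = v.
Proof. by case: v => H e; rewrite /flip /= addbF. Qed.

Lemma flipM v (a b : 'Z_2) : flip v (a * b)%g = flip (flip v a) b.
Proof.
rewrite /flip /= -addbA; congr (_, _ (+) _).
transitivity (odd ((a + b) %% 2)); first by [].
by rewrite odd_mod // oddD.
Qed.

Definition flip_action := TotalAction flip1 flipM.

Lemma flip_flag_complex G : [acts [set: 'Z_2]%SET, on S G | flip_action^*].
Proof.
have flipS (a : 'Z_2) s : s \in S G -> flip_action^*%act s a \in S G.
  move=> /flag_complexP[s0 sG sE]; apply/flag_complexP; split.
  - by apply: contra s0; rewrite /= /setact imset_eq0.
  - by move=> _ /imsetP[v vs ->]; exact: (sG v vs).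
  move=> _ _ /imsetP[v vs ->] /imsetP[w ws ->] i vi wi.
  by rewrite /= (sE v w vs ws i).
apply/actsP => a _ s; apply/idP/idP => [|]; last exact: flipS.
by move/(flipS a^-1%g); rewrite actK.
Qed.

End FlagComplex.

(** * Sperner's lemma for the cube *)

Section Sperner.
Variables (n N : nat) (label : {ffun 'I_n -> nat} -> nat).

Local Notation "\xor_ ( i | P ) F" := (\big[addb/false]_(i | P) F)
  (at level 41, F at level 41, i at level 50, format "\xor_ ( i  |  P )  F").

(** Dropping [j] leaves the labels below [k] exactly when the full list of labels is [l j] together
    with [iota 0 k]. If this happens for some [j0], the facets counted are those with [l j = l j0]:
    one of them if [l j0 = k], two otherwise. *)
Lemma xor_facets (k : nat) (l : nat -> nat) :
  (forall j, j <= k -> l j <= k) ->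
  \big[addb/false]_(j <- iota 0 k.+1)
     perm_eq [seq l i | i <- iota 0 k.+1 & i != j] (iota 0 k) =
  perm_eq [seq l i | i <- iota 0 k.+1] (iota 0 k.+1).
Proof.
move=> lk; set s := iota 0 k.+1.
have facetE j : j \in s ->
    perm_eq [seq l i | i <- s & i != j] (iota 0 k)
    = perm_eq [seq l i | i <- s] (l j :: iota 0 k).
  move=> js; rewrite -(perm_cons (l j)).
  apply: (elimT permPl); rewrite perm_sym.
  have -> : l j :: [seq l i | i <- s & i != j] = [seq l i | i <- j :: rem j s].
    by rewrite rem_filter ?iota_uniq.
  exact: perm_map (perm_to_rem js).
rewrite (eq_big_seq _ facetE).
have iotaS : perm_eq (iota 0 k.+1) (k :: iota 0 k).
  by rewrite -addn1 iotaD cats1 perm_rcons.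
rewrite (permPr iotaS).
case: (boolP (has (fun j => perm_eq [seq l i | i <- s] (l j :: iota 0 k)) s)).
- move=> /hasP[j0 j0s E].
  under eq_bigr => j _ do rewrite (permPl E).
  rewrite (permPl E).
  have consE x y : perm_eq (x :: iota 0 k) (y :: iota 0 k) = (y == x).
    apply/idP/eqP => [/seq.permP/(_ (pred1 x))|->]; last exact: perm_refl.
    by rewrite /= eqxx; case: eqP => //; lia.
  under eq_bigr => j _ do rewrite consE.
  rewrite consE.
  have -> : \big[addb/false]_(j <- s) (l j == l j0)
            = odd (count_mem (l j0) [seq l i | i <- s]).
    by elim: s {facetE j0s E} => [|x s' IH]; rewrite ?big_nil // big_cons IH /= oddD oddb.
  rewrite (seq.permP E) /= eqxx count_uniq_mem ?iota_uniq // mem_iota add0n.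
  have : l j0 <= k by apply: lk; move: j0s; rewrite mem_iota; lia.
  by case: ltngtP.
- move=> /hasPn noj.
  rewrite big_seq big1 => [|j js]; last exact/negbTE/noj.
  apply/esym/negbTE/negP => E.
  have : k \in [seq l i | i <- s] by rewrite (perm_mem E) inE eqxx.
  case/mapP => j js kE; have := noj j js.
  by rewrite -kE E.
Qed.

(** Kuhn's simplex as a chain from [b] to [b + (1, ..., 1)]: the coordinate [i] is raised in passing
    from vertex [s i] to vertex [(s i).+1]. *)
Definition kuhn_vertex (b : {ffun 'I_n -> 'I_N.+1}) (s : 'S_n) (j : nat) :=
  [ffun i => b i + (s i < j)] : {ffun 'I_n -> nat}.

Hypotheses (labelle : forall x, label x <= n)
  (label_low : forall (x : {ffun 'I_n -> nat}) i, (forall i, x i <= N) -> x i = 0 -> label x != i.+1)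
  (label_high : forall (x : {ffun 'I_n -> nat}) i, (forall i, x i <= N) -> x i = N -> label x != 0).

Definition fixes_from k (s : 'S_n) := [forall i : 'I_n, (k <= i) ==> (s i == i)].

(** Together with [fixes_from k s] this selects the simplices of the face where the coordinates of
    index at least [k] vanish: the first [k.+1] vertices move only in the first [k] directions. *)
Definition kuhn_base k (b : {ffun 'I_n -> 'I_N.+1}) :=
  [forall i : 'I_n, if i < k then b i < N else b i == 0 :> nat].

Definition kuhn_labels b s (js : seq nat) := [seq label (kuhn_vertex b s j) | j <- js].

(** Sperner's count modulo 2 on the k-dimensional face; with exclusive or, the cancellation of
    paired facets becomes an equation. *)
Definition sperner_parity k : bool :=
  \xor_(s | fixes_from k s) \xor_(b | kuhn_base k b)
     perm_eq (kuhn_labels b s (iota 0 k.+1)) (iota 0 k.+1).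

Lemma kuhn_vertex_le k b s j i : kuhn_base k b -> fixes_from k s -> j <= k ->
  kuhn_vertex b s j i <= N.
Proof.
move=> /forallP/(_ i) bP /forallP/(_ i) sP jk; rewrite ffunE.
case: ltnP bP sP => /= ik bP; first by lia.
by move/eqP => ->; lia.
Qed.

(** A label [l.+1 > k] is excluded by [label_low], because the coordinate [l] vanishes on the face.
    This is the bound that [xor_facets] asks for. *)
Lemma kuhn_label_le k b s j : kuhn_base k b -> fixes_from k s -> j <= k ->
  label (kuhn_vertex b s j) <= k.
Proof.
move=> bP sP jk; rewrite leqNgt; apply/negP => lk.
have := labelle (kuhn_vertex b s j).
case E : (label _) lk => [|l] // lk ln.
suff x0 : kuhn_vertex b s j (Ordinal ln) = 0.
  by have := label_low (fun i => kuhn_vertex_le i bP sP jk) x0; rewrite E eqxx.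
rewrite ffunE; move/forallP: bP => /(_ (Ordinal ln)) /=.
move/forallP: sP => /(_ (Ordinal ln)) /=.
have lk' : k <= l by lia.
by rewrite ltnNge lk' /= => /eqP -> /eqP ->; rewrite /= ltnNge (leq_trans jk).
Qed.

Definition kuhn_facet k b s j :=
  perm_eq (kuhn_labels b s [seq l <- iota 0 k.+1 | l != j]) (iota 0 k).

(** Exchanging two consecutive steps of the chain moves only vertex [j.+1], so the facet opposite to
    it is shared by [s] and [s * t]. These have opposite parity, so even and odd permutations
    cancel. *)
Lemma kuhn_facet_interior k j : j.+1 < k -> k <= n ->
  \xor_(s | fixes_from k s) \xor_(b | kuhn_base k b) kuhn_facet k b s j.+1 = false.
Proof.
move=> jk kn.
have j0n : j < n by lia.
have j1n : j.+1 < n by lia.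
pose t : 'S_n := tperm (Ordinal j0n) (Ordinal j1n).
have tfix : forall i : 'I_n, k <= i -> t i = i.
  by move=> i ki; rewrite tpermD // -val_eqE /=; lia.
have tinv : forall i, t (t i) = i by move=> i; exact: tpermK.
have fixM s : fixes_from k (s * t)%g = fixes_from k s.
  apply: eq_forallb => i; case: leqP => //= ki.
  rewrite permM; apply/eqP/eqP => [E|->]; last exact: tfix.
  by rewrite -(tinv (s i)) E tfix.
have lblM b s l : l != j.+1 -> kuhn_vertex b (s * t)%g l = kuhn_vertex b s l.
  move=> lj; apply/ffunP => i; rewrite !ffunE permM; congr (_ + nat_of_bool _).
  rewrite /t; case: tpermP => [->|->|//] /=; lia.
have facetM b s : kuhn_facet k b (s * t)%g j.+1 = kuhn_facet k b s j.+1.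
  congr (perm_eq _ _); apply/eq_in_map => l.
  by rewrite mem_filter => /andP[lj _]; rewrite lblM.
rewrite (bigID (fun s : 'S_n => odd_perm s)) /=.
rewrite (reindex_inj (mulIg t)) /=.
apply/negbTE; rewrite negb_add; apply/eqP.
under eq_bigr => s _ do under eq_bigr => b _ do rewrite facetM.
apply: eq_bigl => s.
  rewrite fixM odd_permM odd_tperm -val_eqE /= addbC.
  by rewrite (_ : j != j.+1); [|lia].
Qed.

(** Following [s] by this cycle makes the last direction of the chain the first one, which matches
    the facet without first vertex of one simplex with the facet without last vertex of the next. *)
Definition cycle_fun k (i : 'I_n) : nat := if i < k then i.+1 else if i == k :> nat then 0 else i.

Lemma cycle_fun_lt k i : k < n -> cycle_fun k i < n.
Proof. by have := ltn_ord i; rewrite /cycle_fun; case: (ltngtP i k) => /=; lia. Qed.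

Lemma cycle_perm k : k < n -> {t : 'S_n | forall i, t i = cycle_fun k i :> nat}.
Proof.
move=> kn; pose f i := Ordinal (cycle_fun_lt i kn).
have finj : injective f.
  move=> x y /(congr1 val) /=; rewrite /cycle_fun => E; apply/val_inj => /=; move: E.
  by case: (ltngtP x k); case: (ltngtP y k) => /=; lia.
by exists (perm finj) => i; rewrite permE.
Qed.

(* Dropping the first vertex of the chain started at [b] along [s] gives the
   chain started one step further along the first direction; so the outer facets
   cancel in pairs, except those on the two faces orthogonal to a direction. *)
Lemma kuhn_facet_outer k : k < n ->
  (\xor_(s | fixes_from k.+1 s) \xor_(b | kuhn_base k.+1 b) kuhn_facet k.+1 b s 0)
  (+) (\xor_(s | fixes_from k.+1 s) \xor_(b | kuhn_base k.+1 b) kuhn_facet k.+1 b s k.+1)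
  = \xor_(s | fixes_from k s) \xor_(b | kuhn_base k b)
      perm_eq (kuhn_labels b s (iota 0 k.+1)) (iota 0 k.+1).
Proof.
move=> kn; pose C b s := perm_eq (kuhn_labels b s (iota 0 k.+1)) (iota 0 k.+1).
have facetlast b s : kuhn_facet k.+1 b s k.+1 = C b s.
  rewrite /kuhn_facet /C; congr (perm_eq (map _ _) _).
  rewrite -[k.+2]addn1 iotaD cats1 filter_rcons add0n eqxx.
  suff /all_filterP -> : all (fun l => l != k.+1) (iota 0 k.+1) by [].
  by apply/allP => x; rewrite mem_iota; lia.
pose kO := Ordinal kn.
have [t tE] := cycle_perm kn.
pose top (s : 'S_n) := (s^-1%g kO).
have topE (s : 'S_n) : s (top s) = kO by rewrite permKV.
have fix_top s : fixes_from k.+1 s -> top s <= k.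
  move=> /forallP/(_ (top s))/implyP; rewrite topE; case: leqP => // h /(_ isT)/eqP.
  by move/(congr1 val) => /=; lia.
have s_lt s (i : 'I_n) : fixes_from k.+1 s -> i <= k -> i != top s -> s i < k.
  move=> sP ik itop; have : s i != kO.
    by apply: contra_neq itop => E; rewrite /top -E permK.
  rewrite -val_eqE /= => neq; case: (ltngtP (s i) k) neq => // h _.
  move/forallP: sP => /(_ (s i))/implyP/(_ h)/eqP/perm_inj E.
  by move: h; rewrite E; lia.
have fixM s : fixes_from k.+1 (s * t)%g = fixes_from k.+1 s.
  apply: eq_forallb => i; case: ltnP => //= ki.
  have tfix (x : 'I_n) : k < x -> t x = x.
    move=> kx; apply: val_inj; rewrite /= tE /cycle_fun.
    by case: (ltngtP _ k) => /=; lia.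
  rewrite permM; apply/eqP/eqP => [E|->]; last exact: tfix.
  by apply: (@perm_inj _ t); rewrite E tfix.
pose P0 (i0 : 'I_n) (b : {ffun 'I_n -> 'I_N.+1}) :=
  [forall i : 'I_n, (i != i0) ==> if i < k.+1 then b i < N else b i == 0 :> nat].
have baseE (i0 : 'I_n) b : i0 <= k -> kuhn_base k.+1 b = P0 i0 b && (b i0 != N :> nat).
  move=> i0k; apply/forallP/andP => [H|[/forallP H bi0] i].
    split; first by apply/forallP => i; apply/implyP => _.
    by have := H i0; rewrite ltnS i0k; lia.
  have := H i; case: eqP => //= -> _; rewrite ltnS i0k.
  by have := ltn_ord (b i0); lia.
(* A step in direction [i0]. The wrap-around of [ordS] makes it injective everywhere, as reindexing
   requires; the base condition [b i0 < N] keeps the wrap from occurring. *)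
pose h (i0 : 'I_n) (b : {ffun 'I_n -> 'I_N.+1}) := [ffun i => if i == i0 then ordS (b i) else b i].
have h_inj (i0 : 'I_n) : injective (h i0).
  move=> b b' /ffunP E; apply/ffunP => i; have := E i; rewrite !ffunE.
  by case: eqP => // _; exact: (can_inj (@ordSK _)).
have facet0 (s : 'S_n) b : fixes_from k.+1 s -> kuhn_base k.+1 b ->
    kuhn_facet k.+1 b (s * t)%g 0 = C (h (top s) b) s.
  move=> sP bP; rewrite /kuhn_facet /C; congr (perm_eq _ _).
  have -> : [seq l <- iota 0 k.+2 | l != 0] = [seq j.+1 | j <- iota 0 k.+1].
    rewrite -(iotaDl 1) -[RHS]/(iota 1 k.+1) -[iota 0 k.+2]/(0 :: iota 1 k.+1).
    rewrite [LHS](_ : _ = [seq l <- iota 1 k.+1 | l != 0]) //.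
    by apply/all_filterP/allP => x; rewrite mem_iota; lia.
  rewrite /kuhn_labels -map_comp; apply/eq_in_map => j; rewrite mem_iota /= => jk.
  congr label; apply/ffunP => i; rewrite !ffunE permM tE /cycle_fun.
  case: (eqVneq i (top s)) => [->|itop].
    rewrite topE /= ltnn eqxx.
    have bl : b (top s) < N.
      by move/forallP: bP => /(_ (top s)); rewrite ltnS fix_top.
    by rewrite /ordS /= modn_small; lia.
  case: (leqP i k) => ik; first by rewrite s_lt // ltnS.
  have si : s i = i by move/forallP: sP => /(_ i)/implyP/(_ ik)/eqP.
  by rewrite si; case: (ltngtP _ k) => /=; lia.
have vertex_le (s : 'S_n) (b : {ffun 'I_n -> 'I_N.+1}) j i : fixes_from k.+1 s ->
    P0 (top s) b -> j <= k -> i != top s -> b i + (s i < j) <= N.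
  move=> /forallP/(_ i)/implyP sP /forallP/(_ i)/implyP bP jk itop; move: (bP itop).
  case: (ltnP k i) => ki; last by rewrite ltnS ki; lia.
  rewrite ltnNge ki /= => /eqP ->; move/eqP: (sP ki) => ->.
  by rewrite add0n ltnNge (leq_trans jk (ltnW ki)).
have step (s : 'S_n) : fixes_from k.+1 s ->
   (\xor_(b | kuhn_base k.+1 b) C (h (top s) b) s) (+) (\xor_(b | kuhn_base k.+1 b) C b s)
   = \xor_(b | P0 (top s) b && (b (top s) == 0 :> nat)) C b s.
  move=> sP; have tk := fix_top _ sP.
  have hP b : kuhn_base k.+1 b = P0 (top s) (h (top s) b) && (h (top s) b (top s) != 0 :> nat).
    rewrite (baseE (top s)) //; congr (_ && _).
      by apply: eq_forallb => i; rewrite ffunE; case: eqP.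
    rewrite ffunE eqxx /=; have := ltn_ord (b (top s)); rewrite ltnS leq_eqVlt.
    case/predU1P => [->|bl]; first by rewrite modnn !eqxx.
    by rewrite modn_small; lia.
  rewrite (eq_bigl _ _ hP).
  rewrite -(reindex_inj (h_inj (top s)) (P := fun b => P0 (top s) b && (b (top s) != 0 :> nat))
     (F := fun b => C b s)) /=.
  rewrite (eq_bigl _ (fun b => C b s) (fun b => baseE (top s) b tk)).
  (* A facet on the far face, where the coordinate is [N], has no label 0 by [label_high], so
     including these facets changes nothing. What remains uncancelled lies on the face where the
     coordinate is 0. *)
  have -> : \xor_(b | P0 (top s) b && (b (top s) != N :> nat)) C b s
            = \xor_(b | P0 (top s) b) C b s.
    rewrite [RHS](bigID (fun b : {ffun 'I_n -> 'I_N.+1} => b (top s) == N :> nat)) /=.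
    rewrite [X in _ = X (+) _]big1 // => b /andP[bP /eqP bN].
    apply/negbTE/negP => Cb.
    have /mapP[j] : 0 \in kuhn_labels b s (iota 0 k.+1) by rewrite (perm_mem Cb) mem_iota.
    rewrite mem_iota add0n ltnS /= => jk; apply/eqP; rewrite eq_sym.
    apply: (label_high (i := top s)) => [i|]; last first.
      by rewrite ffunE topE /= bN ltnNge jk addn0.
    rewrite ffunE; case: (eqVneq i (top s)) => [->|itop].
      by rewrite topE /= bN ltnNge jk addn0.
    exact: vertex_le.
  rewrite [X in _ (+) X](bigID (fun b : {ffun 'I_n -> 'I_N.+1} => b (top s) == 0 :> nat)) /=.
  by rewrite addbC -addbA addbb addbF.
have -> : \xor_(s | fixes_from k.+1 s) \xor_(b | kuhn_base k.+1 b) kuhn_facet k.+1 b s 0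
        = \xor_(s | fixes_from k.+1 s) \xor_(b | kuhn_base k.+1 b) C (h (top s) b) s.
  rewrite (reindex_inj (mulIg t)) /=; apply: eq_big => [s|s]; first exact: fixM.
  by rewrite fixM => sP; apply: eq_bigr => b; exact: facet0.
rewrite -big_split /=.
have E s : fixes_from k.+1 s ->
    (\xor_(b | kuhn_base k.+1 b) C (h (top s) b) s) (+)
      (\xor_(b | kuhn_base k.+1 b) kuhn_facet k.+1 b s k.+1) =
    if fixes_from k s then \xor_(b | kuhn_base k b) C b s else false.
  move=> sP; under [X in _ (+) X]eq_bigr => b _ do rewrite facetlast.
  rewrite step //; case: ifPn => [sPk|sNP].
    have topk : top s = kO.
      move/forallP: sPk => /(_ kO)/implyP/(_ (leqnn _))/eqP sk.
      by rewrite /top -[in LHS]sk permK.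
    apply: eq_bigl => b; rewrite topk; apply/andP/forallP => [[/forallP H b0] i|H].
      case: (eqVneq i kO) => [->|ik] /=; first by rewrite ltnn.
      move: (H i); rewrite ik /= ltnS leq_eqVlt; move: ik; rewrite -val_eqE /= => /negbTE ->.
      by [].
    split; last by have := H kO; rewrite /= ltnn.
    apply/forallP => i; apply/implyP; rewrite -val_eqE /= => ik.
    by have := H i; rewrite ltnS [i <= k]leq_eqVlt (negbTE ik).
  (* If the last direction is some [top s < k], the facet lies where that coordinate vanishes and
     misses the label [(top s).+1], which is at most [k]. Only the face of direction [k]
     survives. *)
  apply: big1 => b /andP[bP /eqP b0]; apply/negbTE/negP.
  have toplt : top s < k.
    rewrite ltn_neqAle fix_top // andbT; apply: contra sNP => /eqP topk.
    apply/forallP => i; apply/implyP; rewrite leq_eqVlt => /predU1P[ki|ki].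
      have iO : i = kO by apply: val_inj.
      have topO : top s = kO by apply: val_inj.
      by rewrite iO -{1}topO topE.
    by move/forallP: sP => /(_ i)/implyP/(_ ki).
  move=> Cb; have /mapP[j] : (top s).+1 \in kuhn_labels b s (iota 0 k.+1).
    by rewrite (perm_mem Cb) mem_iota.
  rewrite mem_iota add0n ltnS /= => jk; apply/eqP; rewrite eq_sym.
  apply: label_low => [i|]; last first.
    by rewrite ffunE topE /= b0 ltnNge jk.
  rewrite ffunE; case: (eqVneq i (top s)) => [->|itop].
    by rewrite topE /= b0 ltnNge jk.
  exact: vertex_le.
rewrite (eq_bigr _ E) -big_mkcondr; apply: eq_bigl => s.
apply/andP/forallP => [[_ /forallP]//|H]; split; last exact/forallP.
by apply/forallP => i; apply/implyP => /ltnW ki; move: (H i); rewrite ki.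
Qed.

Lemma sperner_parityS k : k < n -> sperner_parity k.+1 = sperner_parity k.
Proof.
move=> kn; rewrite {2}/sperner_parity -(kuhn_facet_outer kn).
have -> : sperner_parity k.+1 =
    \big[addb/false]_(j <- iota 0 k.+2)
      \xor_(s | fixes_from k.+1 s) \xor_(b | kuhn_base k.+1 b) kuhn_facet k.+1 b s j.
  rewrite exchange_big /=; apply: eq_bigr => s sP.
  rewrite exchange_big /=; apply: eq_bigr => b bP.
  have lk j : j <= k.+1 -> label (kuhn_vertex b s j) <= k.+1 by exact: kuhn_label_le.
  exact: (esym (xor_facets lk)).
rewrite -[k.+2]addn1 iotaD big_cat [iota (0 + _) 1]/= big_seq1 add0n; congr (_ (+) _).
rewrite [iota _ _]/= big_cons big_seq big1 => [|[|j]]; do 1?[exact: addbF]; rewrite mem_iota // => jk.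
by rewrite kuhn_facet_interior //; lia.
Qed.

Lemma sperner_odd k : k <= n -> sperner_parity k.
Proof.
elim: k => [_|k IH kn]; last by rewrite sperner_parityS // IH // ltnW.
rewrite /sperner_parity (big_pred1 1%g) => [|s]; last first.
  rewrite /=; apply/forallP/eqP => [H|-> i]; last by rewrite perm1 eqxx implybT.
  by apply/permP => i; rewrite perm1; move: (H i) => /= /eqP.
have b0 : kuhn_base 0 [ffun => ord0] by apply/forallP => i; rewrite ffunE.
rewrite (big_pred1 [ffun => ord0]) => [|b]; last first.
  rewrite /=; apply/idP/eqP => [/forallP H|->//].
  by apply/ffunP => i; rewrite ffunE; apply/val_inj/eqP; exact: (H i).
have : label (kuhn_vertex [ffun=> ord0] 1%g 0) <= 0.
  apply: (kuhn_label_le (k := 0)) => //.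
  by apply/forallP => i; rewrite perm1 eqxx implybT.
by rewrite /= leqn0 => /eqP ->.
Qed.

Theorem sperner_cube : exists b : {ffun 'I_n -> nat}, forall l, l <= n ->
  exists2 x : {ffun 'I_n -> nat}, label x = l &
    forall i, b i <= x i <= (b i).+1 /\ b i < N.
Proof.
have odd_n := sperner_odd (leqnn n).
case: (pickP (fun sb : 'S_n * {ffun 'I_n -> 'I_N.+1} => kuhn_base n sb.2 &&
   perm_eq (kuhn_labels sb.2 sb.1 (iota 0 n.+1)) (iota 0 n.+1))) => [[s b] /= /andP[bP full]|none].
  exists [ffun i => b i : nat] => l ln.
  have : l \in kuhn_labels b s (iota 0 n.+1) by rewrite (perm_mem full) -[_ :: _]/(iota 0 n.+1) mem_iota.
  case/mapP => j _ ->; exists (kuhn_vertex b s j) => // i; rewrite !ffunE.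
  by move/forallP: bP => /(_ i); rewrite ltn_ord; move=> bN; split=> //; case: (s i < j) => /=; lia.
move: odd_n; rewrite /sperner_parity big1 // => s _; rewrite big1 // => b bP.
by have := none (s, b); rewrite /= bP.
Qed.

End Sperner.

From mathcomp Require Import all_classical all_reals all_analysis.
From mathcomp Require Import ring lra.

Import Order.TTheory GRing.Theory Num.Theory.
Import numFieldNormedType.Exports.
Local Open Scope ring_scope.

(** * Homotopies and spheres *)

Section Topology.
Local Open Scope classical_set_scope.

Lemma cvg_set_type (S : Type) (T : topologicalType) (A : set T) (F : set_system S)
    (FF : Filter F) (u : S -> A) (x : A) :
  (\val (u s) @[s --> F]) --> \val x -> u @ F --> x.
Proof.
move=> cvgu U [B [[C oC <-] Cx] sBU].
have CF : F (fun s => C (\val (u s))) by exact: cvgu (open_nbhs_nbhs (conj oC Cx)).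
exact: (filterS (fun s => sBU (u s)) CF).
Qed.

Lemma val_continuous (T : topologicalType) (A : set T) : continuous (\val : A -> T).
Proof. exact: (@initial_continuous A T set_val). Qed.

Lemma pair_continuous_at (T U V : topologicalType) (f : T -> U) (g : T -> V) (x : T) :
  {for x, continuous f} -> {for x, continuous g} ->
  {for x, continuous (fun x => (f x, g x))}.
Proof. by move=> cf cg; exact: (@cvg_pair _ _ _ _ (nbhs (f x)) (nbhs (g x))). Qed.

Lemma cvg_ptws (V : choiceType) (R : realType) (S : Type) (F : set_system S) (FF : Filter F)
    (f : S -> {ptws V -> R}) (x : {ptws V -> R}) :
  (forall v, f s v @[s --> F] --> x v) -> f @ F --> x.
Proof.
move=> fx; apply/cvg_sup => v U [B [[C oC <-] Cx] sBU].
have CF : F (fun s => C (f s v)) by exact: (fx v _ (open_nbhs_nbhs (conj oC Cx))).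
exact: (filterS (fun s => sBU (f s)) CF).
Qed.

End Topology.

Section Homotopy.
Local Open Scope classical_set_scope.
Variable R : realType.

Definition homotopy (X Y : topologicalType) (H : X * R -> Y) (f g : X -> Y) :=
  [/\ continuous H, forall x, H (x, 0) = f x & forall x, H (x, 1) = g x].

Lemma clamp_continuous : continuous (fun t : R => Num.min (Num.max t 0) 1).
Proof.
move=> t; apply: (@continuous_min _ _ (fun t : R => Num.max t 0) (cst 1)); last exact: cvg_cst.
by apply: (@continuous_max _ _ id (cst 0)); [exact: cvg_id|exact: cvg_cst].
Qed.

(* Clamping the time parameter to [0, 1] removes the "within" from the homotopy. *)
Lemma homotopicP (X Y : topologicalType) (f g : X -> Y) :
  homotopic R f g <-> exists H : X * R -> Y, homotopy H f g.
Proof.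
split=> [[H [cH H0 H1]]|[H [cH H0 H1]]]; last first.
  by exists H; split => //; apply: continuous_subspaceT.
pose K (a : X * R) := (a.1, Num.min (Num.max a.2 0) 1).
pose A := [set: X] `*` `[0, 1]%classic : set (X * R).
have KA a : A (K a).
  split=> //=; rewrite in_itv /= le_min ge_min lexx ler01 orbT !andbT.
  by rewrite le_max lexx orbT.
exists (H \o K); split=> [a|x|x] /=; last 2 first.
- by rewrite /K /= maxxx min_l.
- by rewrite /K /= max_l // minxx.
have cK : K a' @[a' --> a] --> K a.
  apply: pair_continuous_at; first exact: cvg_fst.
  exact: (continuous_comp (@cvg_snd _ _ _ _ _) (@clamp_continuous a.2)).
move=> U /(cH (K a)); rewrite /= /nbhs /= -nbhs_subspace_in; last exact: KA.
by move=> /cK UK; exact: (filterS (fun a' UHa' => UHa' (KA a')) UK).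
Qed.

Lemma homotopic_trans (X Y : topologicalType) (f g h : X -> Y) :
  homotopic R f g -> homotopic R g h -> homotopic R f h.
Proof.
move=> /homotopicP[H [cH H0 H1]] /homotopicP[K [cK K0 K1]]; apply/homotopicP.
have shift b : continuous (fun a : X * R => (a.1, 2 * a.2 + b)).
  move=> a; apply: pair_continuous_at; first exact: cvg_fst.
  apply: cvgD; last exact: cvg_cst.
  by apply: cvgM; [exact: cvg_cst|exact: cvg_snd].
(* After [homotopicP] both homotopies are continuous for all real times, so each branch is
   continuous everywhere and gluing is needed only where [2 * a.2 = 1]; there both branches equal
   [g]. *)
pose L (a : X * R) :=
  if 2 * a.2 <= 1 then H (a.1, 2 * a.2 + 0) else K (a.1, 2 * a.2 + -1).
exists L; split=> [a|x|x]; last 2 first.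
- by rewrite /L /= mulr0 ler01 addr0.
- rewrite /L /= mulr1 ifF; last by apply/negbTE; rewrite -ltNge ltr1n.
  by rewrite -[2]/(1 + 1) addrK.
have cHs : continuous (fun a : X * R => H (a.1, 2 * a.2 + 0)).
  by move=> b; exact: (continuous_comp (shift 0 b) (cH _)).
have cKs : continuous (fun a : X * R => K (a.1, 2 * a.2 + -1)).
  by move=> b; exact: (continuous_comp (shift (-1) b) (cK _)).
have c2 : continuous (fun a : X * R => 2 * a.2).
  by move=> b; apply: cvgM; [exact: cvg_cst|exact: cvg_snd].
case: (ltgtP (2 * a.2) 1) => a2.
- have near1 : \forall b \near a, 2 * b.2 < 1 by exact: (c2 a _ (lt_nbhsl a2)).
  move=> U; have -> : L a = H (a.1, 2 * a.2 + 0) by rewrite /L (ltW a2).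
  move=> /cHs UL; apply: filterS (filterI near1 UL) => b [b2].
  by rewrite /= /L (ltW b2).
- have near1 : \forall b \near a, 1 < 2 * b.2 by exact: (c2 a _ (lt_nbhsr a2)).
  move=> U; have -> : L a = K (a.1, 2 * a.2 + -1) by rewrite /L leNgt a2.
  move=> /cKs UL; apply: filterS (filterI near1 UL) => b [b2].
  by rewrite /= /L leNgt b2.
- have HK : H (a.1, 2 * a.2 + 0) = K (a.1, 2 * a.2 + -1).
    by rewrite a2 addr0 subrr H1 K0.
  move=> U; have -> : L a = H (a.1, 2 * a.2 + 0) by rewrite /L a2 lexx.
  move=> UH; have UK : nbhs (K (a.1, 2 * a.2 + -1)) U by rewrite -HK.
  have UHK : \forall b \near a, U (H (b.1, 2 * b.2 + 0)) /\ U (K (b.1, 2 * b.2 + -1)).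
    by apply: filterI; [exact: (cHs a U UH)|exact: (cKs a U UK)].
  apply: filterS UHK => b [Ub Ub'].
  by rewrite /= /L; case: ifP.
Qed.

Lemma homotopic_comp (X X' Y Y' : topologicalType) (u : X' -> X) (v : Y -> Y') (f g : X -> Y) :
  continuous u -> continuous v -> homotopic R f g -> homotopic R (v \o f \o u) (v \o g \o u).
Proof.
move=> cu cv /homotopicP[H [cH H0 H1]]; apply/homotopicP.
exists (fun a => v (H (u a.1, a.2))); split=> [a|x|x] /=; rewrite ?H0 ?H1 //.
apply: continuous_comp; last exact: cv.
apply: (@continuous_comp _ _ _ (fun a => (u a.1, a.2))); last exact: cH.
apply: pair_continuous_at; last exact: cvg_snd.
by apply: (@continuous_comp _ _ _ fst); [exact: cvg_fst|exact: cu].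
Qed.

End Homotopy.

(** * Norms, coordinates and radial projection to the sphere *)

Section Sphere.
Local Open Scope classical_set_scope.
Variable R : realType.

Local Notation sphere n := (set_type (@unit_sphere R n)).

Lemma coord_le_norm n (x : 'rV[R]_n) i : `|x 0 i| <= `|x|.
Proof.
rewrite [leRHS]/Num.norm /= mx_normrE.
by apply/bigmax_geP; right => /=; exists (0, i).
Qed.

Lemma norm_le_coord n (x : 'rV[R]_n) a : 0 <= a -> (forall i, `|x 0 i| <= a) -> `|x| <= a.
Proof.
move=> a0 xa; rewrite [leLHS]/Num.norm /= mx_normrE.
by apply/bigmax_leP; split=> // -[i j] _ /=; rewrite ord1.
Qed.

Lemma norm_eq_coord n (x : 'rV[R]_n) : x != 0 -> exists i, `|x| = `|x 0 i|.
Proof.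
move=> x0; have : mx_norm x != 0 by apply: contra_neq x0; exact: mx_norm_eq0.
by case/mx_norm_neq0 => -[i j] /=; rewrite ord1; exists j.
Qed.

Lemma cvg_rowP (S : Type) (F : set_system S) n (FF : Filter F)
    (f : S -> 'rV[R]_n) (x : 'rV[R]_n) :
  (forall i, f s 0 i @[s --> F] --> x 0 i) -> f @ F --> x.
Proof.
move=> fx; apply/cvg_ballP => e e0; rewrite near_map.
have : forall i, \forall s \near F, ball (x 0 i) e (f s 0 i).
  by move=> i; move/cvg_ballP: (fx i) => /(_ e e0).
move=> /filter_forall; apply: filterS => s xs; split=> // i j.
by rewrite ord1.
Qed.

Lemma cvg_sumr (T : Type) (F : set_system T) (FF : Filter F) (I : Type) (r : seq I)
    (P : pred I) (f : I -> T -> R) (a : I -> R) :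
  (forall i, P i -> f i x @[x --> F] --> a i) ->
  \sum_(i <- r | P i) f i x @[x --> F] --> \sum_(i <- r | P i) a i.
Proof. by apply: cvg_big; exact: add_continuous. Qed.

(** On row vectors [|x|] is the maximum norm, whose unit ball is the cube of the Sperner argument;
    [unit_sphere] is Euclidean, so both norms are in use. *)
Definition l2norm n (x : 'rV[R]_n) := Num.sqrt (\sum_i x 0 i ^+ 2).

Lemma l2norm_gt0 n (x : 'rV[R]_n) : x != 0 -> 0 < l2norm x.
Proof.
move=> x0; have [i xi] := norm_eq_coord x0; rewrite sqrtr_gt0 (bigD1 i) //=.
rewrite ltr_pwDl ?sumr_ge0 // => [|j _]; last exact: sqr_ge0.
by rewrite lt_neqAle sqr_ge0 eq_sym sqrf_eq0 -normr_eq0 -xi normr_eq0 x0.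
Qed.

Lemma l2norm_continuous n : continuous (@l2norm n).
Proof.
have csum : continuous (fun x : 'rV[R]_n => \sum_i x 0 i ^+ 2).
  move=> x; apply: (@cvg_sumr _ (nbhs x)) => i _.
  have ci : (fun y : 'rV[R]_n => y 0 i) @ nbhs x --> x 0 i by exact: coord_continuous.
  exact: (cvgM ci ci).
by move=> x; exact: (continuous_comp (csum x) (@sqrt_continuous R _)).
Qed.

Lemma l2normZ n a (x : 'rV[R]_n) : 0 <= a -> l2norm (a *: x) = a * l2norm x.
Proof.
move=> a0; rewrite /l2norm; under eq_bigr => i _ do rewrite mxE exprMn.
by rewrite -mulr_sumr sqrtrM ?sqr_ge0 // sqrtr_sqr ger0_norm.
Qed.

Lemma unit_sphereP n (x : 'rV[R]_n) : unit_sphere x <-> l2norm x = 1.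
Proof.
rewrite /unit_sphere /l2norm /=; split=> [->|x1]; first by rewrite sqrtr1.
by rewrite -[LHS]sqr_sqrtr ?x1 ?expr1n // sumr_ge0 // => i _; exact: sqr_ge0.
Qed.

Lemma unit_sphere_neq0 n (x : sphere n) : \val x != 0.
Proof.
have /set_mem/unit_sphereP := valP x; apply: contra_eq_neq => ->.
by rewrite /l2norm big1 ?sqrtr0 ?(eq_sym 0) ?oner_eq0 // => i _; rewrite mxE expr0n.
Qed.

Lemma normalize_sphere n (z : 'rV[R]_n) : z != 0 ->
  (l2norm z)^-1 *: z \in @unit_sphere R n.
Proof.
move=> z0; apply/mem_set/unit_sphereP.
by rewrite l2normZ ?invr_ge0 ?sqrtr_ge0 // mulVf // gt_eqF // l2norm_gt0.
Qed.

(** Radial projection, made total by the value [d] at the origin, where the continuity lemma claims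
    nothing. *)
Definition sphere_pt n (d : sphere n) (z : 'rV[R]_n) : sphere n :=
  insubd d ((l2norm z)^-1 *: z).

Lemma val_sphere_pt n (d : sphere n) z : z != 0 ->
  \val (sphere_pt d z) = (l2norm z)^-1 *: z.
Proof.
by move=> z0; rewrite val_insubd normalize_sphere.
Qed.

Lemma sphere_ptZ n (d : sphere n) a (x : sphere n) : 0 < a ->
  sphere_pt d (a *: \val x) = x.
Proof.
move=> a0; apply: val_inj; rewrite val_sphere_pt; last first.
  by rewrite scaler_eq0 negb_or gt_eqF //= unit_sphere_neq0.
have /set_mem/unit_sphereP x1 := valP x.
by rewrite l2normZ ?ltW // x1 mulr1 scalerA mulVf ?scale1r ?gt_eqF.
Qed.

Lemma sphere_pt_continuous n (d : sphere n) z : z != 0 ->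
  {for z, continuous (sphere_pt d)}.
Proof.
move=> z0; apply: (@cvg_set_type _ _ _ (nbhs z)); rewrite val_sphere_pt //.
have z0near : \forall z' \near z, z' != 0.
  have : \forall z' \near z, 0 < l2norm z'.
    exact: (@l2norm_continuous n z _ (lt_nbhsr (l2norm_gt0 z0))).
  apply: filterS => z'; apply: contraTneq => ->.
  by rewrite /l2norm big1 ?sqrtr0 ?ltxx // => i _; rewrite mxE expr0n.
have : (l2norm z')^-1 *: z' @[z' --> z] --> (l2norm z)^-1 *: z.
  exact: cvgZ (cvgV (lt0r_neq0 (l2norm_gt0 z0)) (@l2norm_continuous n z)) cvg_id.
apply: cvg_trans; apply: near_eq_cvg.
by apply: filterS z0near => z' z'0; rewrite val_sphere_pt.
Qed.

End Sphere.

(** * Spheres of different dimensions *)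

Section Domination.
Local Open Scope classical_set_scope.
Variable R : realType.
Local Notation sphere n := (set_type (@unit_sphere R n)).

Lemma intr_lt1_eq0 (z : int) : `|z%:~R : R| < 1 -> z = 0.
Proof.
by rewrite -intr_norm -[1]/(1%:~R) ltr_int => z1; lia.
Qed.

(* A Kuhn triangulation with mesh 1/N: a point gets the colour ceil(N x - t) for an
   offset t among m equally spaced ones that keeps every coordinate of N x - t away
   from the integers.  A coordinate equal to 1 or -1 rules out no offset and each
   other coordinate rules out at most one. *)
Lemma kuhn_colouring (m : nat) (delta : R) : 0 < delta ->
  exists c : 'rV[R]_m -> 'rV[R]_m,
    (forall x, `|x| = 1 -> `|c x - x| <= delta) /\
    (forall x0 : 'rV[R]_m, exists2 s : seq 'rV[R]_m, (size s <= m)%N &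
       \forall x \near x0, `|x| = 1 -> c x \in s).
Proof.
move=> d0; case: m => [|m].
  exists id; split=> [x _|x0]; first by rewrite subrr normr0 ltW.
  exists [::] => //; apply: (@nearW _ (nbhs x0)) => x.
  have -> : x = 0 by apply/rowP => -[].
  by rewrite normr0 => /eqP; rewrite eq_sym oner_eq0.
pose N := (Num.truncn delta^-1).+1%:R : R.
have N0 : 0 < N by rewrite ltr0n.
have Nd : N^-1 <= delta.
  rewrite -[leRHS]invrK lef_pV2 ?posrE ?invr_gt0 //.
  by apply: ltW; rewrite /N truncnS_gt.
pose M := m.+1%:R : R; have M0 : 0 < M by rewrite ltr0n.
(* Midpoints of the intervals of length [1 / M] in [0, 1]. Modulo 1 two offsets are at least
   [2 * mu] apart, so a coordinate spoils at most one of them; each is at least [mu] from the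
   integers, so a coordinate 1 or -1 spoils none. *)
pose t (j : 'I_m.+1) := (2 * j%:R + 1) / (2 * M) : R.
pose mu := (2 * M)^-1; have mu0 : 0 < mu by rewrite invr_gt0 mulr_gt0.
pose u j (x : 'rV[R]_m.+1) i := N * x 0 i - t j.
pose w j x i := Num.ceil (u j x i).
have ceil_u j x i : (w j x i)%:~R - 1 < u j x i <= (w j x i)%:~R.
  by have := ceil_itv (u j x i); rewrite intrB.
pose good j x := [forall i, (w j x i)%:~R - 1 + mu <= u j x i <= (w j x i)%:~R - mu].
pose vert j x : 'rV[R]_m.+1 := \row_i ((w j x i)%:~R / N).
pose c x := if [pick j | good j x] is Some j then vert j x else 0.
have ex_good x : `|x| = 1 -> exists j, good j x.
  move=> x1; apply: contrapT => nogood.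
  have bad j : exists i, exists a : int, `|u j x i - a%:~R| < mu.
    have /negP/forallPn[i ni] : ~ good j x by move=> gj; apply: nogood; exists j.
    exists i; apply: contrapT => /forallNP H; move/negP: ni; apply.
    have := H (w j x i); have := H (w j x i - 1).
    have /andP[] := ceil_u j x i; rewrite intrB !ltr_norml.
    by move=> w1 w2 /negP + /negP; rewrite !negb_and -!leNgt => /orP[] ? /orP[] ?; lra.
  have /choice[b bP] := bad.
  (* Were every offset bad, [b] would be an injection between sets of equal size, hence onto, and
     would reach the coordinate of absolute value 1. *)
  have b_inj : injective b.
    move=> j j' bjj'; have [a ja] := bP j; have [a' ja'] := bP j'.
    rewrite -bjj' in ja'.
    have : `|((j%:Z - j'%:Z) + m.+1%:Z * (a - a'))%:~R : R| < 1.
      have -> : ((j%:Z - j'%:Z) + m.+1%:Z * (a - a'))%:~R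
              = M * ((u j' x (b j) - a'%:~R) - (u j x (b j) - a%:~R)) :> R.
        rewrite !(intrD, intrM, intrB, intrN) /u /t -!pmulrn -/M.
        by field; rewrite gt_eqF.
      rewrite normrM gtr0_norm // mulrC -ltr_pdivlMr // div1r.
      have -> : M^-1 = mu + mu by rewrite /mu; field; rewrite gt_eqF.
      by rewrite (le_lt_trans (ler_normB _ _)) // ltrD.
    move/intr_lt1_eq0; set k := a - a' => E; apply: val_inj => /=.
    have jm := ltn_ord j; have jm' := ltn_ord j'.
    have : k = 0 \/ 1 <= k \/ k <= -1 by lia.
    by case=> [k0|[k1|k1]]; nia.
  have [i0] : exists i, `|x| = `|x 0 i|.
    by apply: norm_eq_coord; rewrite -normr_eq0 x1 oner_eq0.
  rewrite x1 => xi0.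
  have [j bj] : exists j, b j = i0 by have [b' _ b'K] := injF_bij b_inj; exists (b' i0).
  have [a ja] := bP j; rewrite -bj in xi0.
  have [e xe] : exists e : int, x 0 (b j) = e%:~R.
    case: (ger0P (x 0 (b j))) xi0 => _ xe; first by exists 1.
    by exists (-1); rewrite intrN -[1%:~R]/1 xe opprK.
  (* This integer is odd, yet closeness below [mu] would make it smaller than 1 in absolute
     value. *)
  have : `|(2 * m.+1%:Z * ((Num.truncn delta^-1).+1%:Z * e - a) - (2 * j%:Z + 1))%:~R : R| < 1.
    have -> : (2 * m.+1%:Z * ((Num.truncn delta^-1).+1%:Z * e - a) - (2 * j%:Z + 1))%:~R
            = 2 * M * (u j x (b j) - a%:~R) :> R.
      rewrite !(intrD, intrM, intrB, intrN) /u /t xe -!pmulrn -/M -/N.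
      by field; rewrite gt_eqF.
    by rewrite normrM gtr0_norm ?mulr_gt0 // mulrC -ltr_pdivlMr ?mulr_gt0 // div1r.
  by move/intr_lt1_eq0; set q := (_ * e - a) => E; nia.
have t01 j : 0 < t j < 1.
  have num0 : 0 < 2 * j%:R + 1 :> R by rewrite ltr_wpDl ?mulr_ge0 ?ler0n.
  rewrite /t divr_gt0 ?mulr_gt0 //=.
  rewrite ltr_pdivrMr ?mulr_gt0 // mul1r /M -(@natr1 R m).
  have jm : j%:R <= m%:R :> R by rewrite ler_nat -ltnS.
  by lra.
exists c; split=> [x x1|x0].
  have [j gj] := ex_good x x1; rewrite /c; case: pickP => [k gk|/(_ j)]; last by rewrite gj.
  apply: norm_le_coord => [|i]; first exact: ltW.
  rewrite !mxE; apply: le_trans Nd; rewrite -[N^-1]mul1r ler_pdivlMr //.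
  rewrite -{2}(gtr0_norm N0) -normrM mulrBl mul1r divfK ?gt_eqF // ler_norml.
  have /andP[t0 t1] := t01 k; move/forallP: gk => /(_ i)/andP[].
  by rewrite /u => ? ?; apply/andP; split; lra.
exists [seq vert j x0 | j <- enum 'I_m.+1]; first by rewrite size_map size_enum_ord.
(* A good offset at [x] leaves a margin [mu] on both sides, so its ceilings are the same at [x0]:
   every colour near [x0] is some [vert j x0]. *)
have : \forall x \near x0, `|x0 - x| < mu / N.
  by have /cvgrPdist_lt := @cvg_id _ (nbhs x0); apply; rewrite divr_gt0.
apply: filterS => x xx0 x1; rewrite /c.
have [j gj] := ex_good x x1; case: pickP => [k gk|/(_ j)]; last by rewrite gj.
suff -> : vert k x = vert k x0 by apply: map_f; rewrite mem_enum.
apply/rowP => i; rewrite !mxE; congr (_%:~R / _); apply/esym/eqP.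
rewrite ceil_eq intrB; move/forallP: gk => /(_ i)/andP[lo hi].
have : `|u k x0 i - u k x i| < mu.
  have -> : u k x0 i - u k x i = (x0 - x) 0 i * N by rewrite /u !mxE; ring.
  rewrite normrM (gtr0_norm N0) -ltr_pdivlMr //.
  exact: le_lt_trans (coord_le_norm _ _) xx0.
by rewrite ltr_norml => /andP[? ?]; apply/andP; split; lra.
Qed.

(** Uniform continuity around the compact unit sphere of the maximum norm. The point [v] may leave
    that sphere, as the colours given by [kuhn_colouring] do. *)
Lemma near_sphere_uniform (m n : nat) (h : 'rV[R]_m -> 'rV[R]_n) (eta : R) :
  (forall z, z != 0 -> {for z, continuous h}) -> 0 < eta ->
  exists delta : R, [/\ 0 < delta, delta < 1 &
    forall x v, `|x| = 1 -> `|v - x| <= delta -> `|h v - h x| < eta].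
Proof.
move=> ch eta0; pose K : set 'rV[R]_m := [set x | `|x| = 1].
have Kc : compact K.
  apply: bounded_closed_compact.
    by exists 1; split=> // M M1 x /= ->; exact: ltW.
  apply: (@closed_comp _ _ (fun x : 'rV[R]_m => `|x|) [set 1]); last exact: closed_eq.
  by move=> x _; exact: norm_continuous.
pose P (k : nat) (x : 'rV[R]_m) := forall v, `|v - x| <= k.+1%:R^-1 -> `|h v - h x| < eta.
have cover x : K x -> \forall x' \near x & k \near \oo, P k x'.
  move=> x1; have x0 : x != 0 by rewrite -normr_eq0 (x1 : _ = _) oner_eq0.
  have : \forall y \near x, `|h x - h y| < eta / 2.
    by have /cvgrPdist_lt := ch x x0; apply; rewrite divr_gt0.
  move=> /nbhs_ballP[e /= e0 eP].
  exists (ball x (e / 2), [set k : nat | k.+1%:R^-1 < e / 2]) => /=.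
    split; first by apply: nbhsx_ballx; rewrite divr_gt0.
    have e20 : 0 < e / 2 by rewrite divr_gt0.
    exact: (near_infty_natSinv_lt (PosNum e20)).
  move=> [x' k] /= [xx' ke] v vx'.
  move: xx'; rewrite -ball_normE /ball_ /= => xx'.
  have xv : ball x e v.
    rewrite -ball_normE /ball_ /= [e]splitr.
    rewrite (le_lt_trans (ler_distD x' _ _)) // ltrD // distrC.
    exact: le_lt_trans vx' ke.
  have xx'e : ball x e x'.
    by rewrite -ball_normE /ball_ /=; apply: lt_trans xx' _; lra.
  have := eP v xv; have := eP x' xx'e; rewrite /= => h1 h2.
  by rewrite (le_lt_trans (ler_distD (h x) _ _)) // [eta]splitr ltrD // distrC.
have [/(_ Kc) Kcover _] := compact_near_coveringP K.
have nearP : \forall k \near \oo, K `<=` P k by exact: Kcover.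
have [k [k1 kP]] : exists k, (1 <= k)%N /\ K `<=` P k.
  by apply: (@filter_ex _ \oo); apply: filterI nearP; exact: nbhs_infty_ge.
exists k.+1%:R^-1; split=> [||x v x1 vx]; last exact: kP.
- by rewrite invr_gt0.
- by rewrite invf_lt1 // ltr1n.
Qed.

Definition sign_label n (y : 'rV[R]_n) : nat :=
  if [pick i | 0 < y 0 i] is Some i then i.+1 else 0%N.

Lemma sign_label_le n (y : 'rV[R]_n) : (sign_label y <= n)%N.
Proof. by rewrite /sign_label; case: pickP => [i _|_]. Qed.

Lemma sign_label0 n (y : 'rV[R]_n) i : 0 < y 0 i -> sign_label y != 0%N.
Proof. by move=> yi; rewrite /sign_label; case: pickP => // /(_ i); rewrite yi. Qed.

Lemma sign_labelS n (y : 'rV[R]_n) (i : 'I_n) : y 0 i <= 0 -> sign_label y != i.+1.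
Proof.
move=> yi; rewrite /sign_label; case: pickP => // j yj; apply/eqP => -[/val_inj ji].
by rewrite ji ltNge yi in yj.
Qed.

(** If the large coordinate [i] is positive, it stays so nearby and label 0 is missing; if negative,
    label [i.+1] is missing. *)
Lemma sign_label_near n (y : 'rV[R]_n) i eta : eta < `|y 0 i| ->
  exists2 l, (l <= n)%N & forall y', `|y' - y| <= eta -> sign_label y' != l.
Proof.
have close y' : `|y' - y| <= eta -> `|y' 0 i - y 0 i| <= eta.
  by move=> yy'; have := coord_le_norm (y' - y) i; rewrite !mxE => /le_trans; apply.
case: (lerP 0 (y 0 i)) => yi; rewrite ?(ger0_norm yi) ?(ltr0_norm yi) => eta_lt.
- exists 0%N => // y' /close; rewrite ler_norml => /andP[? ?].
  by apply: (@sign_label0 _ _ i); lra.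
- exists i.+1 => // y' /close; rewrite ler_norml => /andP[? ?].
  by apply: (@sign_labelS _ _ i); lra.
Qed.

(** Otherwise each of the [n] squares is at most [1 / (n + 1)] and their sum is below 1. Any
    positive bound independent of [y] would do; this one becomes [eta] below. *)
Lemma sphere_big_coord n (y : sphere n) : exists i, n.+1%:R^-1 < `|\val y 0 i|.
Proof.
apply: contrapT => /forallNP small; have := set_mem (valP y).
rewrite /unit_sphere /=; apply/eqP; rewrite lt_eqF //.
apply: (@le_lt_trans _ _ (n%:R * n.+1%:R^-1)).
  rewrite mulr_natl -[X in _ *+ X]card_ord -sumr_const.
  apply: ler_sum => i _.
  rewrite -real_normK ?num_real //.
  have /negP := small i; rewrite -leNgt => yi.
  apply: le_trans (_ : n.+1%:R^-1 ^+ 2 <= _); first by rewrite lerXn2r ?nnegrE ?invr_ge0.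
  by rewrite expr2 ler_piMl ?invr_ge0 // invf_le1 // ler1n.
by rewrite ltr_pdivrMr // mul1r ltr_nat.
Qed.

(* Compactness turns the discrete lemma into a statement about a single point. *)
Lemma sperner_point n (L : 'rV[R]_n -> nat) :
  (forall x, (L x <= n)%N) ->
  (forall (x : 'rV[R]_n) i, `|x| = 1 -> x 0 i = -1 -> L x != i.+1) ->
  (forall (x : 'rV[R]_n) i, `|x| = 1 -> x 0 i = 1 -> L x != 0%N) ->
  ~ forall p : 'rV[R]_n, `|p| <= 1 ->
      exists2 l, (l <= n)%N & \forall x \near p, `|x| <= 1 -> L x != l.
Proof.
move=> Ln Llow Lhigh missing.
pose K : set 'rV[R]_n := [set x | `|x| <= 1].
have Kc : compact K.
  apply: bounded_closed_compact.
    by exists 1; split=> // M M1 x /= x1; exact: le_trans x1 (ltW M1).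
  apply: (@closed_comp _ _ (fun x : 'rV[R]_n => `|x|) [set x | x <= 1]); last exact: closed_le.
  by move=> x _; exact: norm_continuous.
pose P (N : nat) (p : 'rV[R]_n) := exists2 l, (l <= n)%N &
  forall x, `|x| <= 1 -> `|x - p| <= 2 / N.+1%:R -> L x != l.
have cover p : K p -> \forall p' \near p & N \near \oo, P N p'.
  move=> p1; have [l ln /nbhs_ballP[e /= e0 eP]] := missing p p1.
  exists (ball p (e / 2), [set N : nat | N.+1%:R^-1 < e / 4]) => /=.
    split; first by apply: nbhsx_ballx; rewrite divr_gt0.
    have e40 : 0 < e / 4 by rewrite divr_gt0.
    exact: (near_infty_natSinv_lt (PosNum e40)).
  move=> [p' N] /= [pp' Ne]; exists l => // x x1 xp'; apply: eP => //.
  move: pp'; rewrite -!ball_normE /ball_ /= => pp'; rewrite [e]splitr.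
  rewrite (le_lt_trans (ler_distD p' _ _)) // ltrD // distrC (le_lt_trans xp') //.
  by move: Ne; set q := _^-1 => Ne; lra.
have [/(_ Kc) Kcover _] := compact_near_coveringP K.
have nearP : \forall N \near \oo, K `<=` P N by exact: Kcover.
have [N NP] : exists N, K `<=` P N by exact: (@filter_ex _ \oo _ _ nearP).
(* The grid cuts [-1, 1] into [N.+1] steps of length [2 / N.+1], the radius used in [P N]: the cell
   of [sperner_cube] then shows all labels within that radius of [pt b]. *)
pose pt (a : {ffun 'I_n -> nat}) : 'rV[R]_n := \row_i (2 * (a i)%:R / N.+1%:R - 1).
have N0 : 0 < N.+1%:R :> R by [].
have pt_le (a : {ffun 'I_n -> nat}) : (forall i, (a i <= N.+1)%N) -> `|pt a| <= 1.
  move=> aN; apply: norm_le_coord => // i; rewrite mxE ler_norml.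
  have ai : (a i)%:R <= N.+1%:R :> R by rewrite ler_nat.
  have q1 : (a i)%:R / N.+1%:R <= 1 :> R by rewrite ler_pdivrMr // mul1r.
  have q0 : 0 <= (a i)%:R / N.+1%:R :> R by rewrite divr_ge0.
  by move: q0 q1; rewrite -mulrA; set q := (a i)%:R / _ => q0 q1; apply/andP; split; lra.
have pt_eq1 (a : {ffun 'I_n -> nat}) i : (forall i, (a i <= N.+1)%N) -> `|pt a 0 i| = 1 -> `|pt a| = 1.
  move=> aN ai; apply/le_anti; rewrite pt_le //= -ai; exact: coord_le_norm.
have low (a : {ffun 'I_n -> nat}) i : (forall i, (a i <= N.+1)%N) -> a i = 0%N -> L (pt a) != i.+1.
  move=> aN ai; have pti : pt a 0 i = -1 by rewrite mxE ai mulr0 mul0r sub0r.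
  by apply: Llow (pti); apply: (pt_eq1 _ i) => //; rewrite pti normrN1.
have high (a : {ffun 'I_n -> nat}) i : (forall i, (a i <= N.+1)%N) -> a i = N.+1 -> L (pt a) != 0%N.
  move=> aN ai; have pti : pt a 0 i = 1.
    by rewrite mxE ai mulfK ?gt_eqF // -[2]/(1 + 1) addrK.
  by apply: Lhigh (pti); apply: (pt_eq1 _ i) => //; rewrite pti normr1.
have [b bP] := sperner_cube (fun a => Ln (pt a)) low high.
have b_lt i : (b i < N.+1)%N by have [x _ /(_ i)[]] := bP 0%N (leq0n _).
have [l ln miss] := NP (pt b) (pt_le b (fun i => ltnW (b_lt i))).
have [x Lx xb] := bP l ln.
have xN i : (x i <= N.+1)%N by have [/andP[_ h] h'] := xb i; exact: leq_trans h _.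
move/eqP: Lx; apply/negP; apply: miss; first exact: pt_le.
apply: norm_le_coord => [|i]; first by rewrite divr_ge0.
rewrite !mxE opprB addrA subrK -mulrBl -mulrBr.
rewrite normrM (ger0_norm (x := N.+1%:R^-1)) ?invr_ge0 // ler_pM2r ?invr_gt0 //.
rewrite normrM ger0_norm // -[leRHS]mulr1 ler_pM2l //.
have [/andP[bx xb1] _] := xb i; rewrite -natrB // normr_nat -[leRHS]/(1%:R) ler_nat.
by lia.
Qed.

(* Label the points of the cube [-1, 1]^n by the signs of: a homotopy from f o g to the
   identity on the collar 1/2 <= |p|; a fine colouring of f o g on 1/4 <= |p| < 1/2; and a
   constant on |p| < 1/4.  Near a point with |p| > 1/4 the values labelled are close to
   each other and away from 0, so some label is missing; near one with |p| <= 1/4 at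
   most m + 1 of the n + 1 labels are used. *)
Theorem sphere_not_dominated m n (f : sphere m -> sphere n) (g : sphere n -> sphere m) :
  (m < n)%N -> continuous f -> continuous g -> ~ homotopic R (f \o g) idfun.
Proof.
move=> mn cf cg /homotopicP[H [cH H0 H1]].
have n0 : (0 < n)%N by case: n mn {f g cf cg H cH H0 H1}.
have x0 : sphere n.
  exists (delta_mx 0 (Ordinal n0)); apply/mem_set.
  rewrite /unit_sphere /= (bigD1 (Ordinal n0)) //= mxE !eqxx expr1n big1 ?addr0 // => i /negbTE i0.
  by rewrite mxE i0 andbF expr0n.
pose d := g x0.
pose h z := \val (f (sphere_pt d z)).
have ch z : z != 0 -> {for z, continuous h}.
  move=> z0; apply: (@continuous_comp _ _ _ (sphere_pt d) (fun y => \val (f y))).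
    exact: sphere_pt_continuous.
  exact: (continuous_comp (@cf _) (@val_continuous _ _ _)).
pose eta : R := n.+1%:R^-1.
have eta0 : 0 < eta by rewrite invr_gt0.
have eta20 : 0 < eta / 2 by rewrite divr_gt0.
have [delta [del0 del1 hdel]] := near_sphere_uniform ch eta20.
have [c [c_near c_few]] := kuhn_colouring m del0.
pose U p := sphere_pt x0 p.
(* The colouring is controlled on the unit sphere of the maximum norm. As [h] is constant along
   rays, rescaling to [Z p] keeps the value [f (g (U p))]. *)
pose Z p : 'rV[R]_m := `|\val (g (U p))|^-1 *: \val (g (U p)).
have gU0 p : 0 < `|\val (g (U p))| by rewrite normr_gt0 unit_sphere_neq0.
have Z1 p : `|Z p| = 1 by rewrite normrZ normfV normr_id mulVf // gt_eqF.
have hZ p : h (Z p) = \val (f (g (U p))).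
  by rewrite /h /Z sphere_ptZ // invr_gt0.
pose Lab p : nat := if `|p| < 1 / 4 then 0%N
  else if `|p| < 1 / 2 then sign_label (h (c (Z p)))
  else sign_label (\val (H (U p, 2 * `|p| - 1))).
(* On the boundary of the cube the homotopy is at time 1, the identity, so the label comes from the
   signs of [x] itself and obeys the boundary conditions. *)
have Lab1 x : `|x| = 1 -> Lab x = sign_label ((l2norm x)^-1 *: x) /\ 0 < (l2norm x)^-1.
  move=> x1; have x_neq0 : x != 0 by rewrite -normr_eq0 x1 oner_eq0.
  split; last by rewrite invr_gt0 l2norm_gt0.
  have lt14 : (1 < 1 / 4 :> R) = false by apply/negbTE; rewrite -leNgt; lra.
  have lt12 : (1 < 1 / 2 :> R) = false by apply/negbTE; rewrite -leNgt; lra.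
  rewrite /Lab x1 lt14 lt12 mulr1 -[2]/(1 + 1) addrK H1 /=; congr sign_label; exact: val_sphere_pt.
have cU p : p != 0 -> {for p, continuous U} by exact: sphere_pt_continuous.
have cgU p : p != 0 -> {for p, continuous (fun x => g (U x))}.
  by move=> p0; exact: (continuous_comp (cU p p0) (@cg _)).
have cfgU p : p != 0 -> {for p, continuous (fun x => \val (f (g (U x))))}.
  move=> p0; apply: (@continuous_comp _ _ _ (fun x => g (U x)) (fun y => \val (f y))).
    exact: cgU.
  exact: (continuous_comp (@cf _) (@val_continuous _ _ _)).
have cHU p : p != 0 -> {for p, continuous (fun x => \val (H (U x, 2 * `|x| - 1)))}.
  move=> p0.
  apply: (@continuous_comp _ _ _ (fun x => (U x, 2 * `|x| - 1)) (fun y => \val (H y))).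
    apply: pair_continuous_at; first exact: cU.
    apply: (@cvgB _ _ _ (nbhs p)); last exact: cvg_cst.
    by apply: (@cvgM _ _ (nbhs p)); [exact: cvg_cst|exact: norm_continuous].
  exact: (continuous_comp (@cH _) (@val_continuous _ _ _)).
have cZ p : p != 0 -> {for p, continuous Z}.
  move=> p0; have cv : {for p, continuous (fun x => \val (g (U x)))}.
    exact: (continuous_comp (cgU p p0) (@val_continuous _ _ _)).
  apply: (@cvgZ _ _ _ (nbhs p) _ (fun x => `|\val (g (U x))|^-1)); last exact: cv.
  apply: (@cvgV _ _ (nbhs p)); first by rewrite gt_eqF.
  exact: (continuous_comp cv (@norm_continuous _ _ _)).
have norm_lt (p : 'rV[R]_n) a : `|p| < a -> \forall x \near p, `|x| < a.
  by move=> pa; exact: (@norm_continuous _ _ p _ (lt_nbhsl pa)).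
have norm_gt (p : 'rV[R]_n) a : a < `|p| -> \forall x \near p, a < `|x|.
  by move=> pa; exact: (@norm_continuous _ _ p _ (lt_nbhsr pa)).
refine (@sperner_point n Lab _ _ _ _).
- by move=> x; rewrite /Lab; do 2 (case: ifP => _ //); exact: sign_label_le.
- move=> x i x1 xi; have [-> l0] := Lab1 x x1.
  by apply: sign_labelS; rewrite mxE xi mulrN1 oppr_le0 ltW.
- move=> x i x1 xi; have [-> l0] := Lab1 x x1.
  by apply: (@sign_label0 _ _ i); rewrite mxE xi mulr1.
move=> p p1; case: (ltP `|p| (1 / 4)) => p4.
  exists 1%N => //; apply: filterS (norm_lt p _ p4) => x x4 _.
  by rewrite /Lab x4.
have p0 : p != 0 by rewrite -normr_gt0; lra.
case: (leP `|p| (1 / 4)) => p4'.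
  have [s sm snear] := c_few (Z p).
  pose ls := 0%N :: [seq sign_label (h z) | z <- s].
  have [l ln lls] : exists2 l, (l <= n)%N & l \notin ls.
    apply: contrapT => /forall2NP none.
    have : (size (iota 0 n.+1) <= size ls)%N.
      apply: uniq_leq_size => [|l]; first exact: iota_uniq.
      by rewrite mem_iota => /andP[_ ln]; have [/(_ ln)//|/negP/negPn] := none l.
    by rewrite size_iota /= size_map; lia.
  exists l => //.
  have near1 : \forall x \near p, `|x| < 1 / 2 by apply: norm_lt; lra.
  have near2 : \forall x \near p, `|Z x| = 1 -> c (Z x) \in s by exact: (cZ p p0 _ snear).
  apply: filterS (filterI near1 near2) => x [x2 /(_ (Z1 x)) cs] _.
  apply: contraNneq lls => <-; rewrite /Lab x2; case: ifP => _; first by rewrite inE eqxx.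
  by rewrite in_cons (map_f (fun z => sign_label (h z)) cs) orbT.
have close (y : sphere n) :
    (\forall x \near p, `|x| < 1 / 2 -> `|\val (f (g (U x))) - \val y| < eta / 2) ->
    (\forall x \near p, 1 / 2 <= `|x| -> `|\val (H (U x, 2 * `|x| - 1)) - \val y| <= eta) ->
    exists2 l, (l <= n)%N & \forall x \near p, `|x| <= 1 -> Lab x != l.
  move=> nearA nearB; have [i yi] := sphere_big_coord y.
  have [l ln lP] := sign_label_near yi; exists l => //.
  apply: filterS (filterI (norm_gt p _ p4') (filterI nearA nearB)) => x [x4 [xA xB]] _.
  rewrite /Lab ifF; last by apply/negbTE; rewrite -leNgt ltW.
  case: ltP => x2; apply: lP; last exact: xB.
  (* Half of [eta] pays for replacing [Z x] by its colour, the other half for the distance to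
     [y]. *)
  rewrite (le_trans (ler_distD (h (Z x)) _ _)) // -/eta [eta]splitr lerD //.
    exact/ltW/hdel/c_near/Z1.
  by rewrite hZ ltW // xA.
case: (ltgtP `|p| (1 / 2)) => p2.
- apply: (close (f (g (U p)))).
    have /cvgrPdist_lt/(_ _ eta20) := cfgU p p0.
    by apply: filterS => x; rewrite distrC.
  by apply: filterS (norm_lt p _ p2) => x; case: ltP.
- apply: (close (H (U p, 2 * `|p| - 1))).
    by apply: filterS (norm_gt p _ p2) => x x2; rewrite ltNge (ltW x2).
  have /cvgrPdist_lt/(_ _ eta0) := cHU p p0.
  by apply: filterS => x; rewrite distrC => /ltW.
(* On the interface the homotopy is at time 0 and equals [f \o g], so both labellings are near one
   common value. *)
- apply: (close (f (g (U p)))).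
    have /cvgrPdist_lt/(_ _ eta20) := cfgU p p0.
    by apply: filterS => x; rewrite distrC.
  have /cvgrPdist_lt/(_ _ eta0) := cHU p p0.
  rewrite [X in H (U p, X)](_ : _ = 0) ?H0; last by rewrite p2; lra.
  by apply: filterS => x; rewrite distrC => /ltW.
Qed.

End Domination.

(** * Complexes with signed blocks *)

Section SignedBlocks.
Local Open Scope classical_set_scope.
Variables (R : realType) (V : finType) (K : {set {set V}}) (k : nat).
Variables (blk : V -> option 'I_k) (sgn : V -> bool) (rep : 'I_k -> bool -> V).
(** All that the homotopy type depends on: a simplex carries one sign per block, and [rep] picks a
    vertex of each sign in each block. The vertices [rep j e] span the boundary of a
    cross-polytope. *)
Hypothesis KP : forall s : {set V}, reflect
  [/\ s != finset.set0, {in s, forall v, blk v != None} &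
      {in s &, forall v w, blk v = blk w -> sgn v = sgn w}] (s \in K).
Hypothesis blk_rep : forall j e, blk (rep j e) = Some j.
Hypothesis sgn_rep : forall j e, sgn (rep j e) = e.
Local Notation sphere n := (set_type (@unit_sphere R n)).
Local Notation realization := (set_type (@geom_realization V R K)).

Let sg (e : bool) : R := if e then 1 else -1.

Lemma sg_mul_gt0_inj e e' (a : R) : 0 < sg e * a -> 0 < sg e' * a -> e = e'.
Proof. by rewrite /sg; case: e; case: e' => //; rewrite !mulN1r !mul1r; lra. Qed.

Definition block_coord (x : V -> R) : 'rV[R]_k :=
  \row_j \sum_(v | blk v == Some j) sg (sgn v) * x v.

Lemma sum1_neq0 (x : V -> R) : \sum_v x v = 1 -> exists v, x v != 0.
Proof.
have [v xv|x0] := pickP (fun v => x v != 0); first by exists v.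
rewrite big1 => [/eqP|v _]; first by rewrite eq_sym oner_eq0.
by apply/eqP; have := x0 v; case: eqP.
Qed.

(** Sign agreement with a vector [y] puts the support in a simplex. The criterion serves both the
    points coming from the sphere and the straight-line homotopy. *)
Lemma realizationP (x : V -> R) y : (forall v, 0 <= x v) -> \sum_v x v = 1 ->
  (forall v, x v != 0 -> exists2 j, blk v = Some j & 0 < sg (sgn v) * y j) ->
  (geom_realization K : set {ptws V -> R}) x.
Proof.
move=> x0 x1 xy; split=> //; apply/KP; split=> [|v|v w].
- by apply/finset.set0Pn; have [v xv] := sum1_neq0 x1; exists v; rewrite inE.
- by rewrite inE => /xy[j ->].
- rewrite !inE => /xy[j -> vj] /xy[j' -> wj] [E]; rewrite -{}E in wj.
  exact: sg_mul_gt0_inj vj wj.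
Qed.

(** Signs agree within each block of the support, so nothing cancels in the block sum. *)
Lemma block_coord_gt0 (x : realization) v : \val x v != 0 ->
  exists2 j, blk v = Some j & 0 < sg (sgn v) * block_coord (\val x) 0 j.
Proof.
case: x => x /= /set_mem[x0 x1 /KP[_ xb xs]] xv.
have vin : v \in finset (fun v => x v != 0) by rewrite inE.
have := xb v vin; case Ev : (blk v) => [j|] // _; exists j => //.
rewrite mxE mulr_sumr (bigD1 v) ?Ev //= ltr_pwDl //.
  rewrite mulrA (_ : sg _ * sg _ = 1); last by rewrite /sg; case: sgn; rewrite ?mulr1 ?mulrNN ?mulr1.
  by rewrite mul1r lt_neqAle eq_sym xv x0.
apply: sumr_ge0 => w /andP[/eqP Ew wv].
case: (eqVneq (x w) 0) => [->|xw]; first by rewrite !mulr0.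
have win : w \in finset (fun v => x v != 0) by rewrite inE.
rewrite (xs w v win vin) ?Ew ?Ev // mulrA.
rewrite (_ : sg _ * sg _ = 1) ?mul1r //.
by rewrite /sg; case: sgn; rewrite ?mulr1 ?mulrNN ?mulr1.
Qed.

Lemma block_coord_neq0 (x : realization) : block_coord (\val x) != 0.
Proof.
have [v xv] : exists v, \val x v != 0.
  by have := set_mem (valP x) => -[_ + _]; exact: sum1_neq0.
have [j _] := block_coord_gt0 xv; apply: contraTneq => ->.
by rewrite mxE mulr0 ltxx.
Qed.

Definition to_sphere (x : realization) : sphere k :=
  @exist _ (fun z => z \in @unit_sphere R k) _ (normalize_sphere (block_coord_neq0 x)).

Let l1norm (y : 'rV[R]_k) := \sum_j `|y 0 j|.

Lemma l1norm_gt0 (y : 'rV[R]_k) : y != 0 -> 0 < l1norm y.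
Proof.
move=> y0; have [j yj] := norm_eq_coord y0.
rewrite /l1norm (bigD1 j) //= ltr_pwDl ?sumr_ge0 // -yj normr_gt0 //.
Qed.

Let weight (y : 'rV[R]_k) j e := Num.max 0 (sg e * y 0 j) / l1norm y.

(** The point of the cross-polytope on the ray of [y]: after division by the l1 norm, [|y_j|] goes
    to the vertex of block [j] with the sign of [y_j], and the maximum with 0 kills the opposite
    vertex. *)
Definition block_point (y : 'rV[R]_k) : V -> R :=
  fun v => \sum_j \sum_e (v == rep j e)%:R * weight y j e.

Lemma weight_ge0 y j e : 0 <= weight y j e.
Proof. by rewrite divr_ge0 ?le_max ?lexx // sumr_ge0. Qed.

Lemma sg_max0 (a : R) : \sum_e Num.max 0 (sg e * a) = `|a|.
Proof.
rewrite big_bool /= mul1r mulN1r; case: (leP 0 a) => a0.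
  by rewrite max_l ?addr0 ?oppr_le0 // ger0_norm.
by rewrite add0r ltr0_norm // max_r // oppr_ge0 ltW.
Qed.

Lemma sg_sg_max0 (a : R) : \sum_e sg e * Num.max 0 (sg e * a) = a.
Proof.
rewrite big_bool /= !mul1r !mulN1r; case: (leP 0 a) => a0.
  by rewrite max_l ?oppr0 ?addr0 ?oppr_le0.
by rewrite add0r max_r ?opprK // oppr_ge0 ltW.
Qed.

Lemma block_point_ge0 y v : 0 <= block_point y v.
Proof. by do 2 apply: sumr_ge0 => ? _; rewrite mulr_ge0 // weight_ge0. Qed.

Lemma block_point_gt0 (y : 'rV[R]_k) v : y != 0 -> block_point y v != 0 ->
  exists2 j, blk v = Some j & 0 < sg (sgn v) * y 0 j.
Proof.
move=> y0 yv; apply: contrapT => none; move/eqP: yv; apply.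
apply: big1 => j _; apply: big1 => e _; case: eqP => [ve|_]; last by rewrite mul0r.
rewrite mul1r /weight max_l ?mul0r // leNgt; apply/negP => yj; apply: none.
by exists j; rewrite ve ?blk_rep ?sgn_rep.
Qed.

Lemma block_point_sum (y : 'rV[R]_k) (P : pred V) (a : V -> R) :
  \sum_(v | P v) a v * block_point y v
  = \sum_j \sum_e (P (rep j e))%:R * a (rep j e) * weight y j e.
Proof.
under eq_bigr => v _ do rewrite mulr_sumr.
rewrite exchange_big /=; apply: eq_bigr => j _.
under eq_bigr => v _ do rewrite mulr_sumr.
rewrite exchange_big /=; apply: eq_bigr => e _.
rewrite big_mkcond (bigD1 (rep j e)) //= eqxx big1 ?addr0 => [|v /negbTE ->].
  by case: P; rewrite !(mul1r, mul0r).
by rewrite mul0r mulr0; case: P.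
Qed.

Lemma block_point_sum1 (y : 'rV[R]_k) : y != 0 -> \sum_v block_point y v = 1.
Proof.
move=> y0; under eq_bigr => v _ do rewrite -[block_point y v]mul1r.
rewrite (block_point_sum y xpredT) /=.
under eq_bigr => j _.
  under eq_bigr => e _ do rewrite !mul1r.
  rewrite -mulr_suml sg_max0; over.
by rewrite -mulr_suml mulfV // gt_eqF // l1norm_gt0.
Qed.

Lemma block_coordK (y : 'rV[R]_k) : y != 0 ->
  block_coord (block_point y) = (l1norm y)^-1 *: y.
Proof.
move=> y0; apply/rowP => i; rewrite !mxE block_point_sum.
rewrite (bigD1 i) //= [X in _ + X]big1 => [|j ji]; last first.
  by apply: big1 => e _; rewrite blk_rep (inj_eq Some_inj) (negbTE ji) !mul0r.
under eq_bigr => e _ do rewrite blk_rep eqxx mul1r sgn_rep mulrA.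
by rewrite -mulr_suml sg_sg_max0 addr0 mulrC.
Qed.

Lemma block_point_realization (y : 'rV[R]_k) : y != 0 ->
  block_point y \in (geom_realization K : set {ptws V -> R}).
Proof.
move=> y0; apply/mem_set/(@realizationP _ (y 0)).
- exact: block_point_ge0.
- exact: block_point_sum1.
- by move=> v; exact: block_point_gt0.
Qed.

Definition of_sphere (y : sphere k) : realization :=
  @exist _ (fun x => x \in (geom_realization K : set {ptws V -> R})) _ (block_point_realization (unit_sphere_neq0 y)).

Lemma of_sphereK : cancel of_sphere to_sphere.
Proof.
move=> y; apply: val_inj; have y0 := unit_sphere_neq0 y.
rewrite /= block_coordK // l2normZ ?invr_ge0 ?ltW ?l1norm_gt0 //.
have /set_mem/unit_sphereP -> := valP y.
by rewrite mulr1 scalerA invrK mulfV ?scale1r // gt_eqF // l1norm_gt0.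
Qed.

Lemma coord_realization_continuous (v : V) : continuous (fun x : realization => (\val x : V -> R) v).
Proof.
move=> x; have cx := @val_continuous _ (geom_realization K : set {ptws V -> R}) x.
exact: (continuous_comp cx (@proj_continuous _ _ v _)).
Qed.

Lemma to_sphere_continuous : continuous to_sphere.
Proof.
move=> x; apply: (@cvg_set_type _ _ _ (nbhs x)) => /=.
have cb : (fun x : realization => block_coord (\val x)) @ nbhs x --> block_coord (\val x).
  apply: (@cvg_rowP _ _ (nbhs x)) => j.
  rewrite (_ : (fun z : realization => _) = fun z : realization =>
    \sum_(v | blk v == Some j) sg (sgn v) * (\val z : V -> R) v); last first.
    by apply/funext => z; rewrite mxE.
  rewrite mxE; apply: (@cvg_sumr _ _ (nbhs x)) => v _.
  by apply: (@cvgM _ _ (nbhs x)); [exact: cvg_cst|exact: coord_realization_continuous].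
apply: (@cvgZ _ _ _ (nbhs x) _ (fun z => (l2norm (block_coord (\val z)))^-1)); last exact: cb.
apply: (@cvgV _ _ (nbhs x)); first by rewrite gt_eqF // l2norm_gt0 // block_coord_neq0.
exact: (continuous_comp cb (@l2norm_continuous _ _ _)).
Qed.

Lemma of_sphere_continuous : continuous of_sphere.
Proof.
move=> y; apply: (@cvg_set_type _ _ _ (nbhs y)) => /=.
apply: (@cvg_ptws _ _ _ (nbhs _)) => v; rewrite /block_point /=.
apply: (@cvg_sumr _ _ (nbhs y)) => j _; apply: (@cvg_sumr _ _ (nbhs y)) => e _.
have cj i : (fun y : sphere k => \val y 0 i) @ nbhs y --> \val y 0 i.
  exact: (continuous_comp (@val_continuous _ _ y) (@coord_continuous R 1 k 0 i _)).
apply: (@cvgM _ _ (nbhs y)); first exact: cvg_cst.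
apply: (@cvgM _ _ (nbhs y)).
  apply: (@continuous_max _ _ (cst 0) (fun y : sphere k => sg e * \val y 0 j)).
    exact: cst_continuous.
  by apply: (@cvgM _ _ (nbhs y)); [exact: cvg_cst|exact: cj].
apply: (@cvgV _ _ (nbhs y)); first by rewrite gt_eqF // l1norm_gt0 // unit_sphere_neq0.
apply: (@cvg_sumr _ _ (nbhs y)) => i _.
exact: (continuous_comp (cj i) (@norm_continuous _ _ _)).
Qed.

(* x and its image under of_sphere o to_sphere have the same sign on each block, so
   they lie in a common simplex. *)
Lemma of_to_sphere_homotopic : homotopic R (of_sphere \o to_sphere) idfun.
Proof.
pose c (t : R) := Num.min (Num.max t 0) 1.
have c01 t : 0 <= c t <= 1.
  by rewrite /c le_min ge_min lexx ler01 orbT !andbT le_max lexx orbT.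
pose L (a : realization * R) : V -> R := fun v =>
  (1 - c a.2) * (\val (of_sphere (to_sphere a.1)) : V -> R) v + c a.2 * (\val a.1 : V -> R) v.
have LK a : L a \in (geom_realization K : set {ptws V -> R}).
  have /andP[c0 c1] := c01 a.2.
  have [x0 x1 _] := set_mem (valP a.1).
  have [y0 y1 _] := set_mem (valP (of_sphere (to_sphere a.1))).
  apply/mem_set/(@realizationP _ (block_coord (\val a.1) 0)).
  - by move=> v; rewrite addr_ge0 // mulr_ge0 // subr_ge0.
  - by rewrite big_split /= -!mulr_sumr x1 y1 !mulr1 subrK.
  (* A vertex outside the support of the first point lies in that of its image, whose signs are
     those of [to_sphere], a positive multiple of [block_coord]. *)
  move=> v Lv; case: (eqVneq ((\val a.1 : V -> R) v) 0) => [xv|]; last exact: block_coord_gt0.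
  have : (\val (of_sphere (to_sphere a.1)) : V -> R) v != 0.
    by apply: contraNneq Lv => yv; rewrite /L xv yv !mulr0 addr0.
  move/(block_point_gt0 (unit_sphere_neq0 _)) => [j vj yj]; exists j => //.
  move: yj; rewrite /= mxE mulrCA pmulr_rgt0 // invr_gt0 l2norm_gt0 //.
  exact: block_coord_neq0.
apply/homotopicP; exists (fun a => @exist _ (fun x => x \in (geom_realization K : set {ptws V -> R})) _ (LK a)); split=> [a|x|x]; last 2 first.
- apply: val_inj; apply/funext => v /=.
  by rewrite /L /c /= maxxx min_l ?ler01 // subr0 mul1r mul0r addr0.
- apply: val_inj; apply/funext => v /=.
  by rewrite /L /c /= max_l ?ler01 // minxx subrr mul0r add0r mul1r.
apply: (@cvg_set_type _ _ _ (nbhs a)) => /=; apply: (@cvg_ptws _ _ _ (nbhs _)) => v.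
have cc : (fun a : realization * R => c a.2) @ nbhs a --> c a.2.
  exact: (continuous_comp (@cvg_snd _ _ _ _ _) (@clamp_continuous R a.2)).
have cx : (fun a : realization * R => (\val a.1 : V -> R) v) @ nbhs a --> (\val a.1 : V -> R) v.
  exact: (continuous_comp (@cvg_fst _ _ _ _ _) (@coord_realization_continuous v _)).
have cy : (fun a : realization * R => (\val (of_sphere (to_sphere a.1)) : V -> R) v) @ nbhs a
    --> (\val (of_sphere (to_sphere a.1)) : V -> R) v.
  have ct : (fun a : realization * R => to_sphere a.1) @ nbhs a --> to_sphere a.1.
    exact: (continuous_comp (@cvg_fst _ _ _ _ _) (@to_sphere_continuous _)).
  have co : (fun a : realization * R => of_sphere (to_sphere a.1)) @ nbhs a
      --> of_sphere (to_sphere a.1).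
    exact: (continuous_comp ct (@of_sphere_continuous _)).
  exact: (continuous_comp co (@coord_realization_continuous v _)).
apply: (@cvgD _ _ _ (nbhs a)); apply: (@cvgM _ _ (nbhs a)) => //.
by apply: (@cvgB _ _ _ (nbhs a)); [exact: cvg_cst|exact: cc].
Qed.

Theorem signed_blocks_sphere : homotopy_sphere R K (k%:Z - 1).
Proof.
exists k => //; exists to_sphere, of_sphere; split.
- exact: to_sphere_continuous.
- exact: of_sphere_continuous.
- exact: of_to_sphere_homotopic.
- apply/homotopicP; exists fst; split=> [a|y|y] /=; first exact: cvg_fst.
    exact/esym/of_sphereK.
  by [].
Qed.

(** The complex is equivalent to both spheres, so passing through it writes the identity of the
    larger sphere, up to homotopy, as a composite through the smaller one. *)
Theorem signed_blocks_sphere_dim (d : int) : homotopy_sphere R K d -> d = k%:Z - 1.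
Proof.
move=> [n -> [f [g [cf cg gf fg]]]]; congr (_ %:Z - 1); apply/eqP.
case: (ltngtP n k) => // nk; exfalso.
- apply: (sphere_not_dominated nk (f := to_sphere \o g) (g := f \o of_sphere)).
  + by move=> y; apply: continuous_comp; [exact: cg|exact: to_sphere_continuous].
  + by move=> y; apply: continuous_comp; [exact: of_sphere_continuous|exact: cf].
  have := homotopic_comp of_sphere_continuous to_sphere_continuous gf.
  by rewrite (_ : (to_sphere \o idfun) \o of_sphere = idfun) //; apply/funext => y; exact: of_sphereK.
- apply: (sphere_not_dominated nk (f := f \o of_sphere) (g := to_sphere \o g)).
  + by move=> y; apply: continuous_comp; [exact: of_sphere_continuous|exact: cf].
  + by move=> y; apply: continuous_comp; [exact: cg|exact: to_sphere_continuous].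
  exact: (homotopic_trans (homotopic_comp cg cf of_to_sphere_homotopic) fg).
Qed.

End SignedBlocks.

(** * Flag complexes as spheres with a free involution *)

Section FlagSpheres.
Variables (R : realType) (E : finType) (M : {set {set E}}) (r : nat).
Hypothesis hM : matroid M r.
Variable F : 'I_r.+1 -> {set E}.
Hypothesis hF : complete_flag M F.
Variable rk : {set E} -> nat.
Hypothesis hrk : flat_rank M r rk.

Lemma flag_complex_sphere G : G \in M ->
  homotopy_sphere R (flag_complex M F G) ((r - rk G)%N%:Z - 1).
Proof.
move=> GM; rewrite -(card_live_blocks hM hrk hF GM).
exact: (signed_blocks_sphere R (flag_complex_blkP hM hF G) (flag_blk_rep hF (G := G))
          (fun j e => erefl)).
Qed.

Lemma flag_complex_sphere_dim G d : G \in M ->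
  homotopy_sphere R (flag_complex M F G) d -> d = (r - rk G)%N%:Z - 1.
Proof.
move=> GM; rewrite -(card_live_blocks hM hrk hF GM).
exact: (signed_blocks_sphere_dim (flag_complex_blkP hM hF G) (flag_blk_rep hF (G := G))
          (fun j e => erefl)).
Qed.

(** The support of a fixed point would contain some vertex and its opposite, which lie in the same
    block with different signs. *)
Lemma flip_free G : free_Z2_action R (flag_complex M F G) (flip_action E).
Proof.
split; first exact: (flip_flag_complex hM hF G).
move=> a a1 x [_ x1 /(flag_complexP hM hF)[_ xG xE]] fx.
have [v xv] := sum1_neq0 x1.
have odd_a : odd (a^-1)%g by case: a a1 {fx} => [[|[|]]].
have flip_v : flip v (a^-1)%g = (v.1, ~~ v.2) by rewrite /flip odd_a addbT.
have xv' : x (v.1, ~~ v.2) != 0 by rewrite -flip_v (congr1 (fun f => f v) fx).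
have [i vi] : exists i, v.1 \in flag_block M F i.
  apply: (flag_block_ex hM hF); have := xG v; rewrite inE => /(_ xv).
  by rewrite mem_coat => /andP[].
have := xE v (v.1, ~~ v.2); rewrite !inE xv xv' => /(_ isT isT i vi vi).
by case: v.2.
Qed.

End FlagSpheres.

Theorem corollary3p2 (R : realType) (E : finType) (M : {set {set E}}) (r : nat)
    (hM : matroid M r) (F : 'I_r.+1 -> {set E}) (hF : complete_flag M F) :
  [/\ homotopy_arrangement R (r%:Z - 1) (flag_complex M F (F ord0))
        [set flag_complex M F G | G in atoms M],
      arrangement_flats (flag_complex M F (F ord0)) (atoms M) (flag_complex M F)
        = [set atoms_below M X | X in M] &
      {in M &, forall X Y,
        (atoms_below M X \subset atoms_below M Y) = (X \subset Y)}].
Proof.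
have [rk hrk] := flat_rank_ex hM; have [rk0 _ _ _] := hrk.
split; [|exact: (arrangement_flats_flag hM hF)|by move=> X Y; exact: (atoms_below_sub hM)].
have F0M : F ord0 \in M by rewrite (flag0 hM hF) (flat_closure_flat hM).
split; first exact: (flag_complex_simplicial hM hF).
split.
  by move=> _ /imsetP[G Ga ->]; exact/(subcomplex_flag_complex hM hF)/atom_flat.
split.
- have := flag_complex_sphere R hM hF hrk F0M.
  by rewrite (flag0 hM hF) rk0 subn0.
- move=> _ /imsetP[G Ga ->]; have GM := atom_flat Ga.
  have := flag_complex_sphere R hM hF hrk GM.
  have := rk_le_r hM hrk GM; rewrite (rk_atom hM hrk Ga) => r1.
  by rewrite -subzn.
- move=> B /(intersection_flag_complex_ex hM hF)[X XM ->]; eexists; exact: (flag_complex_sphere R hM hF hrk XM).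
- exists (flip_action E); first exact: (flip_free R hM hF).
  move=> _ /imsetP[G Ga ->]; exact: (flip_flag_complex hM hF G).
move=> B T d' /(intersection_flag_complex_ex hM hF)[X XM ->] /imsetP[G Ga ->].
move=> /(flag_complex_sphere_dim hM hF hrk XM) -> XG.
have GM := atom_flat Ga; rewrite (flag_complex_sub hM hF) // in XG.
rewrite (flag_complexI hM hF).
have rkXG := rk_join_atom hM hrk XM Ga XG.
have XGM := flat_closure_flat hM (X :|: G)%SET.
(* The join has rank at most [r], so [r - (rk X).+1] is not truncated and the dimension drops by
   exactly one, down to -1 when the join is [E]. *)
have := flag_complex_sphere R hM hF hrk XGM.
have := rk_le_r hM hrk XGM; rewrite rkXG => rX.
by rewrite -!subzn ?(ltnW rX) // -addn1 PoszD opprD addrA.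
Qed.
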